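(* Consider a robust Markov decision process with states $\mathcal{S}=\{1,\dots,S\}$, actions $\mathcal{A}=\{1,\dots,A\}$ and the $s$-rectangular $\phi$-divergence ambiguity set with budget $\kappa>0$ described in the context, let $\mathfrak{J}$ be its robust Bellman operator and let $\overline{R} = (1-\lambda)^{-1}\max\{r_{sas'} : s,s'\in\mathcal{S},\ a\in\mathcal{A}\}$. Assume that the generalized $d_a$-projection $\mathfrak{P}(\overline{\bm{p}}_{sa};\bm{b},\beta)$ can be computed to any accuracy $\delta>0$ in time $\mathcal{O}(h(\delta))$. Then for every $\bm{v}\in\mathbb{R}^S$ with $\bm{v}\le\bm{v}^\star$ and $\bm{r}_{sa}+\lambda\bm{v}\ge\bm{0}$ for all $s\in\mathcal{S}$, $a\in\mathcal{A}$, the robust Bellman iteration $\mathfrak{J}(\bm{v})$ (across all states $s\in\mathcal{S}$) can be computed to any accuracy $\epsilon>0$ in time $$\mathcal{O}\left(A S\cdot h\!\left(\frac{\epsilon\kappa}{2A\overline{R}+A\epsilon}\right)\cdot\log\frac{\overline{R}}{\epsilon}\right).$$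
   Context: Notation: $\Delta_n=\{\bm{p}\in\mathbb{R}^n_+ : \mathbf{e}^\top\bm{p}=1\}$ with $\mathbf{e}$ the all-ones vector; $\min\{\bm{b}\}$ is the smallest component of $\bm{b}$. Inequalities between vectors are component-wise. Robust MDP: finite state space $\mathcal{S}=\{1,\dots,S\}$, finite action space $\mathcal{A}=\{1,\dots,A\}$, discount factor $\lambda\in(0,1)$, rewards $r_{sas'}\in\mathbb{R}_+$ with $\bm{r}_{sa}=(r_{sas'})_{s'\in\mathcal{S}}$, nominal transition probabilities $\overline{\bm{p}}_{sa}\in\Delta_S$ with $\overline{\bm{p}}_{sa}>\bm{0}$. Let $\phi:\mathbb{R}_+\to\mathbb{R}_+$ be convex with $\phi(1)=0$ and define $d_a(\bm{p}_{sa},\overline{\bm{p}}_{sa})=\sum_{s'\in\mathcal{S}}\overline{p}_{sas'}\,\phi(p_{sas'}/\overline{p}_{sas'})$. For a budget $\kappa>0$, the ambiguity set of state $s$ is $\mathcal{P}_s=\{\bm{p}_s=(\bm{p}_{sa})_{a\in\mathcal{A}}\in(\Delta_S)^A : \sum_{a\in\mathcal{A}}d_a(\bm{p}_{sa},\overline{\bm{p}}_{sa})\le\kappa\}$. The robust Bellman operator $\mathfrak{J}:\mathbb{R}^S\to\mathbb{R}^S$ is $$[\mathfrak{J}(\bm{v})]_s=\max_{\bm{\pi}_s\in\Delta_A}\ \min_{\bm{p}_s\in\mathcal{P}_s}\ \sum_{a\in\mathcal{A}}\pi_{sa}\cdot\bm{p}_{sa}^\top(\bm{r}_{sa}+\lambda\bm{v}),\qquad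 s\in\mathcal{S},$$ and $\bm{v}^\star$ denotes the limit of the iteration $\bm{v}^{t+1}=\mathfrak{J}(\bm{v}^t)$ (the fixed point of $\mathfrak{J}$). Accuracy of a Bellman iteration: $\mathfrak{J}(\bm{v})$ is computed to accuracy $\epsilon$ by any $\bm{v}'\in\mathbb{R}^S$ with $\|\bm{v}'-\mathfrak{J}(\bm{v})\|_\infty\le\epsilon$. Generalized $d_a$-projection: for $\bm{b}\in\mathbb{R}^S_+$ and $\beta\in\mathbb{R}_+$, $\mathfrak{P}(\overline{\bm{p}}_{sa};\bm{b},\beta)=\min\{d_a(\bm{p}_{sa},\overline{\bm{p}}_{sa}) : \bm{b}^\top\bm{p}_{sa}\le\beta,\ \bm{p}_{sa}\in\Delta_S\}$. It is infeasible iff $\min\{\bm{b}\}>\beta$ and has value $0$ if $\bm{b}^\top\overline{\bm{p}}_{sa}\le\beta$; these trivial cases are excluded, i.e. the projection is considered for $\min\{\bm{b}\}\le\beta<\bm{b}^\top\overline{\bm{p}}_{sa}$. It is computed to accuracy $\delta$ by any pair $(\underline{d},\overline{d})\in\mathbb{R}^2$ with $\mathfrak{P}(\overline{\bm{p}}_{sa};\bm{b},\beta)\in[\underline{d},\overline{d}]$ and $\overline{d}-\underline{d}\le\delta$. Running time counts elementary operations on real numbers (arithmetic, comparisons, evaluations of elementary functions), each at unit cost.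
   Formalization: Running time also charges one unit per input number (else φ≡0 with constant-time projections refutes the bound, as all AS² rewards must be read), h is taken to be at least 1, and log(R̄/ε) is read as max{1, ln(R̄/ε)} so that the bound makes sense for ε ≥ R̄. *)

(* Defs.v *)
From HB Require Import structures.
From mathcomp Require Import all_boot all_order all_algebra.
From mathcomp Require Import all_classical all_reals all_analysis.
Set Implicit Arguments.
Unset Strict Implicit.
Unset Printing Implicit Defensive.
Import Order.TTheory GRing.Theory Num.Theory.
Import numFieldNormedType.Exports.
Local Open Scope classical_set_scope.
Local Open Scope ring_scope.

(* ---- Model of computation ----------------------------------------------

   A uniform real random-access machine, presented as a structured language.
   A state holds index registers (naturals) and a memory of real cells that is
   addressed by index expressions. Reals are inspected only through the order
   test [BLe]; there is no rounding operation. Every node of an evaluated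
   expression and every executed command costs one unit. *)

Inductive iexpr :=
  | ICst of nat
  | IVar of nat
  | IAdd of iexpr & iexpr
  | ISub of iexpr & iexpr (* truncated *)
  | IMul of iexpr & iexpr.

Inductive elem := EExp | ELn | ESqrt | ESin | ECos | EAtan.

Inductive rexpr (R : Type) :=
  | RCst of R
  | RNat of iexpr (* a natural seen as a real *)
  | RMem of iexpr
  | RAdd of rexpr R & rexpr R
  | RSub of rexpr R & rexpr R
  | RMul of rexpr R & rexpr R
  | RDiv of rexpr R & rexpr R
  | RElem of elem & rexpr R.

Inductive bexpr (R : Type) :=
  | BLe of rexpr R & rexpr R
  | BLt of iexpr & iexpr.

(* [Call p args src len dst out] runs [p] as a subroutine in a fresh memory:
   its first index registers receive [args], its first [len] real cells receive
   the caller's cells [src, src + len), everything else is 0; on termination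
   the first [out] real cells of the subroutine are copied to the caller's cells
   [dst, dst + out), and the rest of the caller's state is unchanged. *)
Inductive com (R : Type) :=
  | Skip
  | ISet of nat & iexpr
  | RSet of iexpr & rexpr R
  | Seq of com R & com R
  | If of bexpr R & com R & com R
  | While of bexpr R & com R
  | Call of com R & seq iexpr & iexpr & iexpr & iexpr & nat.

Arguments Skip {R}.
Arguments ISet {R}.
Arguments RNat {R}.
Arguments RMem {R}.
Arguments BLt {R}.

Section Semantics.
Variable R : realType.

Record state := State { regs : nat -> nat; mem : nat -> R }.

Definition upd (T : Type) (f : nat -> T) (i : nat) (x : T) : nat -> T :=
  fun j => if j == i then x else f j.

(* Cells outside the list hold 0. *)
Definition load (ns : seq nat) (xs : seq R) : state :=
  State (fun i => nth 0%N ns i) (fun i => nth 0 xs i).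

Fixpoint ieval (st : state) (e : iexpr) : nat :=
  match e with
  | ICst n => n
  | IVar x => regs st x
  | IAdd e1 e2 => (ieval st e1 + ieval st e2)%N
  | ISub e1 e2 => (ieval st e1 - ieval st e2)%N
  | IMul e1 e2 => (ieval st e1 * ieval st e2)%N
  end.

Fixpoint icost (e : iexpr) : nat :=
  match e with
  | ICst _ | IVar _ => 1%N
  | IAdd e1 e2 | ISub e1 e2 | IMul e1 e2 => (icost e1 + icost e2).+1
  end.

Definition elem_fun (f : elem) : R -> R :=
  match f with
  | EExp => expR
  | ELn => @ln R
  | ESqrt => Num.sqrt
  | ESin => sin
  | ECos => cos
  | EAtan => atan
  end.

Fixpoint reval (st : state) (e : rexpr R) : R :=
  match e with
  | RCst c => c
  | RNat i => (ieval st i)%:R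
  | RMem i => mem st (ieval st i)
  | RAdd e1 e2 => reval st e1 + reval st e2
  | RSub e1 e2 => reval st e1 - reval st e2
  | RMul e1 e2 => reval st e1 * reval st e2
  | RDiv e1 e2 => reval st e1 / reval st e2
  | RElem f e1 => elem_fun f (reval st e1)
  end.

Fixpoint rcost (e : rexpr R) : nat :=
  match e with
  | RCst _ => 1%N
  | RNat i | RMem i => (icost i).+1
  | RAdd e1 e2 | RSub e1 e2 | RMul e1 e2 | RDiv e1 e2 =>
      (rcost e1 + rcost e2).+1
  | RElem _ e1 => (rcost e1).+1
  end.

Definition beval (st : state) (b : bexpr R) : bool :=
  match b with
  | BLe e1 e2 => reval st e1 <= reval st e2
  | BLt i1 i2 => (ieval st i1 < ieval st i2)%N
  end.

Definition bcost (b : bexpr R) : nat :=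
  match b with
  | BLe e1 e2 => (rcost e1 + rcost e2).+1
  | BLt i1 i2 => (icost i1 + icost i2).+1
  end.

(* [exec c st t st']: started in [st], [c] halts in [st'] after time [t]. *)
Inductive exec : com R -> state -> nat -> state -> Prop :=
  | ExSkip st : exec Skip st 1 st
  | ExISet st x e :
      exec (ISet x e) st (icost e).+1
        (State (upd (regs st) x (ieval st e)) (mem st))
  | ExRSet st i e :
      exec (RSet i e) st (icost i + rcost e).+1
        (State (regs st) (upd (mem st) (ieval st i) (reval st e)))
  | ExSeq c1 c2 st st1 st2 t1 t2 :
      exec c1 st t1 st1 -> exec c2 st1 t2 st2 ->
      exec (Seq c1 c2) st (t1 + t2).+1 st2
  | ExIfT b c1 c2 st st1 t :
      beval st b -> exec c1 st t st1 ->
      exec (If b c1 c2) st (bcost b + t).+1 st1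
  | ExIfF b c1 c2 st st1 t :
      ~~ beval st b -> exec c2 st t st1 ->
      exec (If b c1 c2) st (bcost b + t).+1 st1
  | ExWhileT b c st st1 st2 t1 t2 :
      beval st b -> exec c st t1 st1 -> exec (While b c) st1 t2 st2 ->
      exec (While b c) st (bcost b + t1 + t2).+1 st2
  | ExWhileF b c st :
      ~~ beval st b -> exec (While b c) st (bcost b).+1 st
  | ExCall p args src len dst out st st1 t :
      exec p
        (load [seq ieval st e | e <- args]
              [seq mem st (ieval st src + j)%N | j <- iota 0 (ieval st len)])
        t st1 ->
      exec (Call p args src len dst out) st
        (sumn [seq icost e | e <- args] + icost src + icost len + icost dst
           + ieval st len + t + out).+1
        (State (regs st)
           (fun j => if (ieval st dst <= j < ieval st dst + out)%N
                     then mem st1 (j - ieval st dst)%N else mem st j)).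

(* On the input ([ns], [xs]) the program [p] halts within time [T] and its final
   real memory satisfies [post]. Receiving each number of the input costs one
   unit, so running times are never smaller than the size of the input. *)
Definition solves_in_time (p : com R) (ns : seq nat) (xs : seq R) (T : R)
    (post : (nat -> R) -> Prop) : Prop :=
  exists (t : nat) (st : state),
    [/\ exec p (load ns xs) t st,
        (size ns + size xs + t)%:R <= T &
        post (mem st)].

End Semantics.

(* ---- Robust Markov decision processes ---------------------------------- *)

Definition simplex (R : realType) (n : nat) : set ('I_n -> R) :=
  [set p | (forall i, 0 <= p i) /\ \sum_i p i = 1].

(* Only the values of [phi] on the nonnegative reals matter. *)
Definition divergence_function (R : realType) (phi : R -> R) : Prop :=
  [/\ convex_function (`[0, +oo[%classic : set R) phi,
      forall x, 0 <= x -> 0 <= phi x &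
      phi 1 = 0].

Definition phi_div (R : realType) (phi : R -> R) (n : nat) (p q : 'I_n -> R) : R :=
  \sum_i q i * phi (p i / q i).

Record rmdp (R : realType) (S A : nat) := Rmdp {
  discount : R;
  budget : R;
  reward : 'I_S -> 'I_A -> 'I_S -> R;
  nominal : 'I_S -> 'I_A -> 'I_S -> R;
  discount_gt0 : 0 < discount;
  discount_lt1 : discount < 1;
  budget_gt0 : 0 < budget;
  reward_ge0 : forall s a s', 0 <= reward s a s';
  nominal_simplex : forall s a, simplex (nominal s a);
  nominal_gt0 : forall s a s', 0 < nominal s a s' }.

Section Rmdp.
Variables (R : realType) (phi : R -> R) (S A : nat) (M : rmdp R S A).

Definition ambiguity (s : 'I_S) : set ('I_A -> 'I_S -> R) :=
  [set p | (forall a, simplex (p a)) /\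
           \sum_a phi_div phi (p a) (nominal M s a) <= budget M].

(* The max-min is a sup-inf: a convex [phi] may jump at 0, in which case the
   inner minimum need not be attained. *)
Definition bellman (v : 'I_S -> R) : 'I_S -> R := fun s =>
  sup [set inf [set \sum_a pi a *
                      \sum_s' p a s' * (reward M s a s' + discount M * v s')
               | p in ambiguity s]
      | pi in @simplex R A].

Definition robust_value (vstar : 'I_S -> R) : Prop :=
  exists v0 : 'I_S -> R,
    forall s, (fun t : nat => iter t bellman v0 s) @ \oo --> vstar s.

(* Rewards are nonnegative, so 0 is neutral for their maximum. *)
Definition Rbar : R :=
  (1 - discount M)^-1 *
  \big[Num.max/0]_(s < S) \big[Num.max/0]_(a < A) \big[Num.max/0]_(s' < S)
     reward M s a s'.

End Rmdp.

Definition projection (R : realType) (phi : R -> R) (n : nat)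
    (q b : 'I_n -> R) (beta : R) : R :=
  inf [set phi_div phi p q
      | p in [set p | simplex p /\ \sum_i b i * p i <= beta]].

(* [exists i, b i <= beta] says that the smallest component of [b] is at most
   [beta]. *)
Definition nontrivial_projection (R : realType) (n : nat)
    (q b : 'I_n -> R) (beta : R) : Prop :=
  (exists i, b i <= beta) /\ beta < \sum_i b i * q i.

(* Input: S in register 0; beta, delta, b, nominal distribution in the real
   memory. Output: the two bounds in cells 0 and 1. *)
Definition projections_in_time (R : realType) (phi : R -> R) (S A : nat)
    (M : rmdp R S A) (P : com R) (T : R -> R) : Prop :=
  forall (s : 'I_S) (a : 'I_A) (b : 'I_S -> R) (beta delta : R),
    (forall i, 0 <= b i) -> 0 <= beta ->
    nontrivial_projection (nominal M s a) b beta ->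
    0 < delta ->
    solves_in_time P [:: S]
      ([:: beta; delta] ++ codom b ++ codom (nominal M s a))
      (T delta)
      (fun out => out 0%N <= projection phi (nominal M s a) b beta <= out 1%N
                  /\ out 1%N - out 0%N <= delta).

Definition flat3 (R : Type) (S A : nat) (f : 'I_S -> 'I_A -> 'I_S -> R) : seq R :=
  flatten [seq flatten [seq codom (f s a) | a <- enum 'I_A] | s <- enum 'I_S].

(* Input: S and A in registers 0 and 1; discount factor, budget, epsilon, v,
   rewards and nominal probabilities (in lexicographic order of (s, a, s')) in
   the real memory. Output: component s of the result in cell s. *)
Definition bellman_in_time (R : realType) (phi : R -> R) (S A : nat)
    (M : rmdp R S A) (Q : com R) (v : 'I_S -> R) (eps T : R) : Prop :=
  solves_in_time Q [:: S; A]
    ([:: discount M; budget M; eps] ++ codom v ++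
       flat3 (reward M) ++ flat3 (nominal M))
    T
    (fun out => forall s : 'I_S, `|out s - bellman phi M v s| <= eps).

(* Main.v *)
Require Import Defs.
From HB Require Import structures.
From mathcomp Require Import all_boot all_order all_algebra.
From mathcomp Require Import all_classical all_reals all_analysis.
From mathcomp Require Import ring lra zify.
Import Order.TTheory GRing.Theory Num.Theory.
Import numFieldNormedType.Exports.
Local Open Scope ring_scope.

(* Write b_a = r_sa + lambda v and F(beta) = sum_a P(pbar_sa; b_a, beta). The
   function F is convex and nonincreasing, F = 0 at Rbar, and [J(v)]_s is the
   threshold beyond which F <= kappa. That F(beta) <= kappa implies
   [J(v)]_s <= beta is weak duality. Conversely, if F(c) >= kappa at an interior
   point c, the normalized subgradients of the summands at c form a randomized
   action guaranteeing c, so that no general minimax theorem is needed.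
   Bisecting on [0, Rbar] with projections of accuracy delta, the test errs only
   if F(beta) > kappa - A delta; by convexity of F between beta - eps/2 and Rbar
   this choice of delta then still ensures [J(v)]_s >= beta - eps/2. The
   bisection stops after O(log(Rbar/eps)) halvings, each costing A projections;
   for S >= 2 a projection is never faster than reading its 2S + 2 reals, which
   pays for all the bookkeeping, and for S = 1 every projection is trivial. *)

Set Implicit Arguments.
Unset Strict Implicit.
Unset Printing Implicit Defensive.

(* Both Defs and ssrbool define mem. *)
Local Notation memory := Defs.mem.

(** * Projections and the bisection test *)

Section Projection.
Variables (R : realType) (phi : R -> R).
Hypothesis hphi : divergence_function phi.

Lemma divergence_convex (t x y : R) : 0 <= t <= 1 -> 0 <= x -> 0 <= y ->
  phi (t * x + (1 - t) * y) <= t * phi x + (1 - t) * phi y.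
Proof.
case: hphi => cvx _ _ /andP[t0 t1] x0 y0.
have := cvx (Itv01 t0 t1) x y.
by rewrite !convRE /=; apply; rewrite inE /= in_itv /= andbT.
Qed.

Lemma simplex_mix n (p p' : 'I_n -> R) t : 0 <= t <= 1 ->
  simplex p -> simplex p' -> simplex (fun i => t * p i + (1 - t) * p' i).
Proof.
move=> /andP[t0 t1] [p0 p1] [q0 q1]; split=> [i|].
  by rewrite addr_ge0 ?mulr_ge0 ?subr_ge0.
by rewrite big_split /= -!mulr_sumr p1 q1 !mulr1 subrKC.
Qed.

Lemma simplex_dirac n (i : 'I_n) : simplex (fun j => (j == i)%:R : R).
Proof.
split=> [j|]; first exact: ler0n.
rewrite (bigD1 i) //= eqxx big1 ?addr0 // => j /negbTE -> //.
Qed.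

Lemma sum_dirac n (i : 'I_n) (b : 'I_n -> R) : \sum_j b j * (j == i)%:R = b i.
Proof.
rewrite (bigD1 i) //= eqxx mulr1 big1 ?addr0 // => j /negbTE -> //.
by rewrite mulr0.
Qed.

Lemma mean_ge n (p b : 'I_n -> R) L : simplex p -> (forall i, L <= b i) ->
  L <= \sum_i p i * b i.
Proof.
move=> [p0 p1] Lb; rewrite -[L]mul1r -p1 mulr_suml.
by apply: ler_sum => i _; rewrite ler_wpM2l.
Qed.

Lemma mean_le n (p b : 'I_n -> R) U : simplex p -> (forall i, b i <= U) ->
  \sum_i p i * b i <= U.
Proof.
move=> [p0 p1] Lb; rewrite -[U]mul1r -p1 mulr_suml.
by apply: ler_sum => i _; rewrite ler_wpM2l.
Qed.

Lemma mean_gt n (p b : 'I_n -> R) L : simplex p -> (forall i, L < b i) ->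
  L < \sum_i p i * b i.
Proof.
move=> [p0 p1] Lb.
have [i pi0] : exists i, 0 < p i.
  apply/not_existsP => H; have : \sum_i p i <= 0.
    by apply: sumr_le0 => i _; rewrite leNgt; apply/negP/H.
  by rewrite p1 ler10.
rewrite -[L]mul1r -p1 mulr_suml (bigD1 i) //= [ltRHS](bigD1 i) //=.
apply: ltr_leD; first by rewrite ltr_pM2l.
by apply: ler_sum => j _; rewrite ler_wpM2l // ltW.
Qed.

(** * Convexity and subgradients of the projection of a single action *)

Section OneAction.
Variables (n : nat) (q b : 'I_n -> R).
Hypothesis (q0 : forall i, 0 < q i) (qs : simplex q).

Lemma phi_div_ge0 (p : 'I_n -> R) : simplex p -> 0 <= phi_div phi p q.
Proof.
case: hphi => _ phi0 _ [p0 _]; apply: sumr_ge0 => i _.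
by rewrite mulr_ge0 ?phi0 ?divr_ge0 // ltW.
Qed.

Lemma phi_div_nominal : phi_div phi q q = 0.
Proof.
case: hphi => _ _ phi1; apply: big1 => i _.
by rewrite divff ?phi1 ?mulr0 // gt_eqF.
Qed.

Lemma phi_div_convex (p p' : 'I_n -> R) t :
  0 <= t <= 1 -> simplex p -> simplex p' ->
  phi_div phi (fun i => t * p i + (1 - t) * p' i) q
  <= t * phi_div phi p q + (1 - t) * phi_div phi p' q.
Proof.
move=> t01 [p0 _] [p0' _]; rewrite /phi_div !mulr_sumr -big_split /=.
apply: ler_sum => i _.
rewrite mulrDl -!mulrA.
apply: (@le_trans _ _ (q i * (t * phi (p i / q i) + (1 - t) * phi (p' i / q i)))).
  rewrite ler_wpM2l ?(ltW (q0 i)) // divergence_convex // divr_ge0 // ltW //.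
by rewrite le_eqVlt; apply/orP; left; apply/eqP; ring.
Qed.

Local Notation proj := (projection phi q b).

Lemma projection_has_lbound beta :
  has_lbound [set phi_div phi p q
      | p in [set p | simplex p /\ \sum_i b i * p i <= beta]]%classic.
Proof. by exists 0 => _ [p [ps _] <-]; exact: phi_div_ge0. Qed.

Lemma projection_le beta p : simplex p -> \sum_i b i * p i <= beta ->
  proj beta <= phi_div phi p q.
Proof.
move=> ps bp; apply: ge_inf; first exact: projection_has_lbound.
by exists p.
Qed.

Lemma projection_nonempty beta : (exists i, b i <= beta) ->
  [set phi_div phi p q
      | p in [set p | simplex p /\ \sum_i b i * p i <= beta]]%classic !=set0%classic.
Proof.
move=> [i bi]; eexists; exists (fun j => (j == i)%:R) => //.
by split; [exact: simplex_dirac | rewrite sum_dirac].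
Qed.

(** A convex [phi] may jump at 0, so the infimum may be missed; approximate minimizers replace
    minimizers from here on. *)
Lemma projection_adherent beta eta : 0 < eta -> (exists i, b i <= beta) ->
  exists p, [/\ simplex p, \sum_i b i * p i <= beta &
                phi_div phi p q < proj beta + eta].
Proof.
move=> eta0 /projection_nonempty ne.
have [|_ [p [ps pb] <-] lt] := inf_adherent eta0 (E := [set phi_div phi p q
      | p in [set p | simplex p /\ \sum_i b i * p i <= beta]]%classic).
  by split => //; exact: projection_has_lbound.
by exists p.
Qed.

Lemma projection_ge0 beta : (exists i, b i <= beta) -> 0 <= proj beta.
Proof.
move=> /projection_nonempty ne; apply: lb_le_inf => // _ [p [ps _] <-].
exact: phi_div_ge0.
Qed.

Lemma projection_trivial beta : \sum_i b i * q i <= beta -> proj beta <= 0.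
Proof. by move=> bq; rewrite -phi_div_nominal; apply: projection_le. Qed.

(** Near-minimizers at [x] and [y] mix to a point feasible at the mixed threshold, as the constraint
    is linear and the divergence convex. *)
Lemma projection_convex t x y : 0 <= t <= 1 ->
  (exists i, b i <= x) -> (exists i, b i <= y) ->
  proj (t * x + (1 - t) * y) <= t * proj x + (1 - t) * proj y.
Proof.
move=> t01 fx fy; apply/ler_addgt0Pr => eta eta0.
have [p [ps pb pd]] := projection_adherent eta0 fx.
have [p' [ps' pb' pd']] := projection_adherent eta0 fy.
have /andP[t0 t1] := t01; rewrite -subr_ge0 in t1.
apply: (le_trans (projection_le (simplex_mix t01 ps ps') _)).
  under eq_bigr do rewrite mulrDr !(mulrCA (b _)).
  rewrite big_split /= -!mulr_sumr.
  by apply: lerD; rewrite ler_wpM2l.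
apply: (le_trans (phi_div_convex t01 ps ps')).
have h1 := ler_wpM2l t0 (ltW pd); have h2 := ler_wpM2l t1 (ltW pd').
lra.
Qed.

(** The slope is the infimum of the difference quotients to the right of [c], that is, the right
    derivative. The strict inequality provides a feasible point to the left of [c], whose slope
    bounds these quotients from below. *)
Lemma projection_subgradient c : (exists i, b i < c) ->
  exists2 g, 0 <= g & forall y, (exists i, b i <= y) ->
    proj c - g * (y - c) <= proj y.
Proof.
move=> [i0 bi0].
have fx x : c <= x -> exists i, b i <= x.
  by move=> cx; exists i0; rewrite (le_trans (ltW bi0)).
pose E := [set (proj y - proj c) / (y - c) | y in [set y | c < y]]%classic.
have left_slope x y : x < c -> c < y -> (exists i, b i <= x) ->
    (proj c - proj x) / (c - x) <= (proj y - proj c) / (y - c).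
  move=> xc cy bx; have xy : 0 < y - x by lra.
  (* This weight makes [c] the mixture of [x] and [y], so that convexity compares the slopes on the
     two sides of [c]. *)
  pose t := (y - c) / (y - x).
  have t01 : 0 <= t <= 1.
    by rewrite divr_ge0 ?ler_pdivrMr //=; lra.
  have := projection_convex t01 bx (fx _ (ltW cy)).
  have -> : t * x + (1 - t) * y = c by rewrite /t; field; lra.
  have -> : t * proj x + (1 - t) * proj y =
     ((y - c) * proj x + (c - x) * proj y) / (y - x) by rewrite /t; field; lra.
  rewrite ler_pdivlMr // => H.
  rewrite ler_pdivrMr ?subr_gt0 // mulrAC ler_pdivlMr ?subr_gt0 //; lra.
have lbE : has_lbound E.
  exists ((proj c - proj (b i0)) / (c - b i0)) => _ [y cy <-].
  by apply: left_slope => //; exists i0.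
have neE : E !=set0%classic.
  by eexists; exists (c + 1) => //=; rewrite ltrDl.
have infE y : c < y -> inf E * (y - c) <= proj y - proj c.
  move=> cy; rewrite -ler_pdivlMr ?subr_gt0 //.
  by apply: ge_inf => //; exists y.
exists (- inf E).
  (* The test point lies beyond both [c] and the nominal mean, where the projection is at most 0; a
     positive right derivative would contradict [0 <= proj c]. *)
  rewrite oppr_ge0; have := infE (c + Num.max 1 (\sum_i b i * q i - c)).
  have := @projection_trivial (c + Num.max 1 (\sum_i b i * q i - c)).
  set m := Num.max _ _.
  have m1 : 1 <= m by rewrite le_max lexx.
  have m2 : \sum_i b i * q i - c <= m by rewrite le_max lexx orbT.
  have p0 : 0 <= proj c by apply/projection_ge0/fx.
  move=> H1 H2; have {}H1 : proj (c + m) <= 0 by apply: H1; lra.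
  have {}H2 : inf E * (c + m - c) <= proj (c + m) - proj c by apply: H2; lra.
  rewrite leNgt; apply/negP => E0.
  have : 0 < inf E * (c + m - c) by rewrite mulr_gt0 //; lra.
  lra.
move=> y fy; case: (ltrgtP y c) => [yc|cy|->].
- have : (proj c - proj y) / (c - y) <= inf E.
    by apply: lb_le_inf => // _ [z cz <-]; exact: left_slope.
  rewrite ler_pdivrMr ?subr_gt0 //; lra.
- have := infE _ cy; lra.
- by rewrite subrr mulr0 subr0.
Qed.

End OneAction.

(** * The max-min game of one state and the sum of its projections *)

Section Game.
Variables (n A : nat) (q b : 'I_A -> 'I_n -> R) (kappa : R).
Hypothesis (q0 : forall a i, 0 < q a i) (qs : forall a, simplex (q a)).
Hypothesis (kappa0 : 0 < kappa) (A0 : (0 < A)%N).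

Let amb : set ('I_A -> 'I_n -> R) :=
  [set p | (forall a, simplex (p a)) /\
           \sum_a phi_div phi (p a) (q a) <= kappa]%classic.
Let val (pi : 'I_A -> R) (p : 'I_A -> 'I_n -> R) :=
  \sum_a pi a * \sum_i p a i * b a i.
Let maxmin :=
  sup [set inf [set val pi p | p in amb] | pi in @simplex R A]%classic.
Local Notation proj a := (projection phi (q a) (b a)).

Let amb_nominal : amb q.
Proof.
split=> //; rewrite big1 ?(ltW kappa0) // => a _; exact: phi_div_nominal.
Qed.

Let val_has_lbound pi : simplex pi ->
  has_lbound [set val pi p | p in amb]%classic.
Proof.
move=> pis; exists (- \sum_a \sum_i `|b a i|) => _ [p [ps _] <-].
apply: mean_ge => // a; apply: mean_ge => // i.
rewrite lerNl (bigD1 a) //= (bigD1 i) //=.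
have h1 : 0 <= \sum_(i0 < n | i0 != i) `|b a i0| by apply: sumr_ge0.
have h2 : 0 <= \sum_(i0 < A | i0 != a) \sum_i1 `|b i0 i1|.
  by apply: sumr_ge0 => ? _; apply: sumr_ge0.
have := ler_norm (- b a i); rewrite normrN; lra.
Qed.

Let inf_val_le pi p : simplex pi -> amb p ->
  inf [set val pi p | p in amb]%classic <= val pi p.
Proof. by move=> pis ap; apply: ge_inf; [exact: val_has_lbound|exists p]. Qed.

Lemma maxmin_le c :
  (forall pi eta, simplex pi -> 0 < eta -> exists2 p, amb p & val pi p <= c + eta) ->
  maxmin <= c.
Proof.
move=> H; apply: ge_sup.
  by eexists; exists (fun j => (j == Ordinal A0)%:R) => //; exact: simplex_dirac.
move=> _ [pi pis <-]; apply/ler_addgt0Pr => eta eta0.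
have [p ap pv] := H pi eta pis eta0.
exact: le_trans (inf_val_le pis ap) pv.
Qed.

Lemma maxmin_ge c pi : simplex pi -> (forall p, amb p -> c <= val pi p) ->
  c <= maxmin.
Proof.
move=> pis H.
(* The nominal reply bounds all inner infima at once, so the supremum is that of a bounded set. *)
have ub : has_ubound [set inf [set val pi p | p in amb] | pi in @simplex R A]%classic.
  exists (\sum_a `|\sum_i q a i * b a i|) => _ [pi' [p0 p1] <-].
  apply: le_trans (inf_val_le _ amb_nominal) _ => //.
  apply: mean_le => // a; rewrite (bigD1 a) //=.
  have h2 : 0 <= \sum_(i < A | i != a) `|\sum_i0 q i i0 * b i i0| by apply: sumr_ge0.
  have := ler_norm (\sum_i q a i * b a i); lra.
apply: le_trans (ub_le_sup ub (_ : _ (inf [set val pi p | p in amb]%classic))).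
  apply: lb_le_inf; first by eexists; exists q.
  by move=> _ [p ap <-]; exact: H.
by exists pi.
Qed.

Lemma maxmin_ge_min c a : (forall i, c <= b a i) -> c <= maxmin.
Proof.
move=> H; apply: (maxmin_ge (simplex_dirac a)) => p [ps _].
rewrite /val; under eq_bigr do rewrite mulrC.
by rewrite sum_dirac; apply: mean_ge.
Qed.

Let mean_comm (p f : 'I_n -> R) : \sum_i p i * f i = \sum_i f i * p i.
Proof. by apply: eq_bigr => i _; rewrite mulrC. Qed.

(* Moving a near-optimal p slightly towards the nominal distribution makes room
   in the budget, so it does not matter that the infimum is not attained. *)
Lemma maxmin_le_projection beta : (forall a, exists i, b a i <= beta) ->
  \sum_a proj a beta <= kappa -> maxmin <= beta.
Proof.
move=> fb le_kappa; apply: maxmin_le => pi eta pis eta0.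
pose U := \sum_a `|\sum_i q a i * b a i - beta|.
have U0 : 0 <= U by apply: sumr_ge0.
have [t [t0 t1 tU]] : exists t, [/\ 0 < t, t <= 1 & t * U <= eta].
  exists (eta / (eta + U)); split; first by rewrite divr_gt0 //; lra.
    by rewrite ler_pdivrMr; lra.
  rewrite mulrAC ler_pdivrMr; last lra.
  by rewrite ler_pM2l //; lra.
have A0R : 0 < A%:R :> R by rewrite ltr0n.
(* Summed over the actions, this tolerance exceeds the budget by [kappa * t]; the factor [1 - t] of
   the mixture brings the total down to [kappa - kappa * t ^+ 2]. *)
have eta2 : 0 < kappa * t / A%:R by rewrite divr_gt0 // mulr_gt0.
have /choice[p pP] a := projection_adherent (q0 a) eta2 (fb a).
have t01 : 0 <= t <= 1 by rewrite (ltW t0).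
exists (fun a i => t * q a i + (1 - t) * p a i).
  split=> [a|]; first by case: (pP a) => ? _ _; exact: simplex_mix.
  apply: (@le_trans _ _ (\sum_a (1 - t) * (proj a beta + kappa * t / A%:R))).
    apply: ler_sum => a _; case: (pP a) => ps _ pd.
    apply: le_trans (phi_div_convex (q0 a) t01 (qs a) ps) _.
    rewrite phi_div_nominal // mulr0 add0r ler_wpM2l ?subr_ge0 //; exact: ltW.
  rewrite -mulr_sumr big_split /= sumr_const card_ord -[_ *+ A]mulr_natr.
  rewrite divfK ?gt_eqF //.
  apply: (@le_trans _ _ ((1 - t) * (kappa + kappa * t))).
    by rewrite ler_wpM2l ?subr_ge0 // lerD2r.
  have -> : (1 - t) * (kappa + kappa * t) = kappa - kappa * t ^+ 2 by ring.
  by rewrite gerBl mulr_ge0 ?sqr_ge0 // ltW.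
apply: mean_le => // a.
case: (pP a) => ps pb _.
under eq_bigr do rewrite mulrDl -!mulrA.
rewrite big_split /= -!mulr_sumr.
have h1 : \sum_i q a i * b a i - beta <= U.
  rewrite /U (bigD1 a) //=.
  have h2 : 0 <= \sum_(i < A | i != a) `|\sum_i0 q i i0 * b i i0 - beta|
    by apply: sumr_ge0.
  have := ler_norm (\sum_i q a i * b a i - beta); lra.
have h3 := ler_wpM2l (ltW t0) h1.
have h4 : (1 - t) * \sum_i p a i * b a i <= (1 - t) * beta.
  by rewrite ler_wpM2l ?subr_ge0 // mean_comm.
lra.
Qed.

(* The normalized subgradients of the projections at c form a randomized action
   that guarantees c; this replaces the minimax theorem. *)
Lemma maxmin_ge_projection c : (forall a, exists i, b a i < c) ->
  kappa <= \sum_a proj a c -> c <= maxmin.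
Proof.
move=> fc kle.
have /choice[g gP] a : exists g, 0 <= g /\ forall y, (exists i, b a i <= y) ->
    proj a c - g * (y - c) <= proj a y.
  by have [g g0 gH] := projection_subgradient (q0 a) (qs a) (fc a); exists g.
(* The divergence of [p a] is at least the projection at the mean payoff of [p a], hence at least
   the tangent at [c] evaluated there. Summing over the actions, the budget and
   [kappa <= \sum_a proj a c] force the sign. *)
have key p : amb p -> 0 <= \sum_a g a * (\sum_i p a i * b a i - c).
  move=> [ps dp].
  suff : \sum_a (proj a c - g a * (\sum_i p a i * b a i - c)) <= kappa.
    by rewrite sumrB; lra.
  apply: le_trans dp; apply: ler_sum => a _.
  apply: (@le_trans _ _ (proj a (\sum_i p a i * b a i))).
    apply: (gP a).2; apply/not_existsP => H.
    have := @mean_gt _ _ (b a) (\sum_i p a i * b a i) (ps a).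
    by rewrite ltxx => H'; apply/notF/H' => i; rewrite ltNge; apply/negP/H.
  by apply: projection_le => //; rewrite mean_comm.
pose G := \sum_a g a.
have G0 : 0 <= G by apply: sumr_ge0 => a _; case: (gP a).
(* If all slopes were zero, each projection at [c] would be at most its value at a trivial
   threshold, and their sum could not reach [kappa]. *)
have {G0}G0 : 0 < G.
  rewrite lt_neqAle G0 andbT; apply/eqP => /esym G00.
  have g0 a : g a = 0.
    apply/eqP; move/eqP: G00; rewrite psumr_eq0 ?(fun a _ => (gP a).1) //.
      by move=> /allP/(_ a); rewrite mem_index_enum => /(_ isT).
    by move=> a' _; case: (gP a').
  suff Fle0 : \sum_a proj a c <= 0 by have := lt_le_trans kappa0 kle; rewrite ltNge Fle0.
  apply: sumr_le0 => a _; have := (gP a).2 (Num.max c (\sum_i b a i * q a i)).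
  rewrite g0 mul0r subr0 => H.
  apply: (le_trans (H _)).
    by have [i bi] := fc a; exists i; rewrite le_max (ltW bi).
  by apply: projection_trivial => //; rewrite le_max lexx orbT.
apply: (@maxmin_ge c (fun a => g a / G)).
  split=> [a|]; first by apply: divr_ge0; [case: (gP a)|exact: ltW].
  by rewrite -mulr_suml divff ?gt_eqF.
move=> p /key; rewrite /val.
under eq_bigr do rewrite mulrBr.
rewrite sumrB -mulr_suml => H.
under eq_bigr do rewrite mulrAC.
by rewrite -mulr_suml ler_pdivlMr // mulrC -subr_ge0.
Qed.

(** Let [c = beta - eps / 2]. The projections are at most 0 at [U], so convexity on the segment from
    [c] to [U] bounds their sum at [beta] by [1 - t] times their sum at [c], with [t] the relative
    position of [beta]. The lower bound assumed at [beta] thus grows to [kappa] at [c]. *)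
Lemma maxmin_ge_approx U beta eps : 0 < eps -> 0 <= beta < U ->
  (forall a, \sum_i b a i * q a i <= U) ->
  (forall a, exists i, b a i <= beta) ->
  kappa - kappa * (eps / (2 * U + eps)) <= \sum_a proj a beta ->
  beta - eps / 2 <= maxmin.
Proof.
move=> eps0 /andP[b0 bU] bqU fb kle; set c := beta - eps / 2.
(* An action that pays at least [c] everywhere secures [c] by itself; otherwise [c] is interior to
   the domain of every projection. *)
have [[a Ha]|H] := pselect (exists a, forall i, c <= b a i).
  exact: maxmin_ge_min Ha.
have fc a : exists i, b a i < c.
  apply/not_existsP => H'; apply: H; exists a => i; rewrite leNgt; apply/negP/H'.
apply: maxmin_ge_projection => //.
have Uc : 0 < U - c by rewrite /c; lra.
pose t := (beta - c) / (U - c).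
have t01 : 0 <= t <= 1 by rewrite divr_ge0 ?ler_pdivrMr //= /c; lra.
(* Since [beta >= 0], the length [U - c] is at most [U + eps / 2]. *)
have tt : eps / (2 * U + eps) <= t.
  rewrite ler_pdivlMr // mulrAC ler_pdivrMr; last lra.
  rewrite /c; nra.
have fU a : exists i, b a i <= U.
  by have [i bi] := fb a; exists i; exact: le_trans bi (ltW bU).
have cvx : \sum_a proj a beta <= (1 - t) * \sum_a proj a c.
  rewrite mulr_sumr; apply: ler_sum => a _.
  have fc' : exists i, b a i <= c by have [i /ltW] := fc a; exists i.
  have := projection_convex (q0 a) t01 (fU a) fc'.
  have -> : t * U + (1 - t) * c = beta by rewrite /t; field; lra.
  have := projection_trivial (q0 a) (qs a) (bqU a).
  have /andP[t0 _] := t01 => h1 h2; apply: (le_trans h2).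
  have : t * proj a U <= 0 by rewrite mulr_ge0_le0.
  lra.
have F0 : 0 <= \sum_a proj a c.
  apply: sumr_ge0 => a _; apply: projection_ge0 => //.
  by have [i /ltW] := fc a; exists i.
have t1 : t < 1 by rewrite ltr_pdivrMr // mul1r; lra.
have kt := ler_wpM2l (ltW kappa0) tt.
rewrite -(@ler_pM2l _ (1 - t)) ?subr_gt0 //; lra.
Qed.

End Game.
End Projection.

(** * Cost-bounded Hoare logic *)

Section Logic.
Variable R : realType.
Implicit Types (c : com R) (st : state R) (Q : state R -> Prop).

Definition reaches c st (T : nat) Q :=
  exists t st', [/\ exec c st t st', (t <= T)%N & Q st'].

Lemma reaches_conseq c st T T' Q Q' : reaches c st T Q -> (T <= T')%N ->
  (forall st', Q st' -> Q' st') -> reaches c st T' Q'.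
Proof.
move=> [t [st' [e tT q]]] TT' QQ; exists t, st'; split=> //.
  exact: leq_trans TT'.
exact: QQ.
Qed.

Lemma reaches_seq c1 c2 st T1 T2 T Q1 Q2 : reaches c1 st T1 Q1 ->
  (forall st', Q1 st' -> reaches c2 st' T2 Q2) -> (T1 + T2 < T)%N ->
  reaches (Seq c1 c2) st T Q2.
Proof.
move=> [t [st' [e tT q]]] /(_ _ q) [t2 [st2 [e2 tT2 q2]]] TT.
exists (t + t2).+1, st2; split=> //; first exact: ExSeq e e2.
lia.
Qed.

Lemma reaches_if b c1 c2 st T T' Q :
  (beval st b -> reaches c1 st T Q) -> (~~ beval st b -> reaches c2 st T Q) ->
  (bcost b + T < T')%N -> reaches (If b c1 c2) st T' Q.
Proof.
move=> H1 H2 TT; have [bb|bb] := boolP (beval st b).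
  have [t [st' [e tT q]]] := H1 bb.
  exists (bcost b + t).+1, st'; split=> //; first exact: ExIfT.
  lia.
have [t [st' [e tT q]]] := H2 bb.
exists (bcost b + t).+1, st'; split=> //; first exact: ExIfF.
lia.
Qed.

(** The invariant is indexed by the number of completed iterations and the body is entered only
    below [N], which gives termination and the time bound together. The last summand pays for the
    failing test. *)
Lemma reaches_while b c st N T (I : nat -> state R -> Prop) :
  I 0%N st ->
  (forall k st, I k st -> beval st b -> (k < N)%N /\ reaches c st T (I k.+1)) ->
  reaches (While b c) st (N * (bcost b + T).+1 + (bcost b).+1)
    (fun st' => ~~ beval st' b /\ exists k, I k st').
Proof.
move=> I0 H.
suff gen n : forall k st, (N - k <= n)%N -> I k st ->
    reaches (While b c) st (n * (bcost b + T).+1 + (bcost b).+1)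
      (fun st' => ~~ beval st' b /\ exists k, I k st').
  by apply: (gen N 0%N) => //; lia.
elim: n {I0 st} => [|n IH] k st kn Ik; have [bb|bb] := boolP (beval st b).
- by have [kN _] := H _ _ Ik bb; lia.
- exists (bcost b).+1, st; split=> //; first exact: ExWhileF.
  by split=> //; exists k.
- have [kN [t [st1 [e tT q]]]] := H _ _ Ik bb.
  have [||t2 [st2 [e2 tT2 q2]]] := IH k.+1 st1; [lia|by []|].
  exists (bcost b + t + t2).+1, st2; split=> //; first exact: ExWhileT e2.
  lia.
- exists (bcost b).+1, st; split=> //; first exact: ExWhileF.
    lia.
  by split=> //; exists k.
Qed.

Definition For (x : nat) (n : iexpr) c : com R :=
  Seq (ISet x (ICst 0))
    (While (BLt (IVar x) n) (Seq c (ISet x (IAdd (IVar x) (ICst 1))))).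

(** [I k] describes the loop head with counter [k], so the body is specified with the increment
    already applied. The constants 8 cover tests, counter updates and sequencing. *)
Lemma reaches_for (x : nat) (n : iexpr) c (N T : nat) (I : nat -> state R -> Prop) st :
  I 0%N (State (upd (regs st) x 0%N) (memory st)) ->
  (forall k st, I k st -> ieval st n = N /\ regs st x = k :> nat) ->
  (forall k st, (k < N)%N -> I k st ->
    reaches c st T
      (fun st' => I k.+1 (State (upd (regs st') x (regs st' x + 1)%N) (memory st')))) ->
  reaches (For x n c) st (N * (T + icost n + 8) + icost n + 8) (I N).
Proof.
move=> I0 IN Istep.
(* The bound on [k] is carried along so that the failing test yields [k = N] on exit. *)
pose I' k st := (k <= N)%N /\ I k st.
apply: (@reaches_conseq _ _ _ _ (fun st' => ~~ beval st' (BLt (IVar x) n) /\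
    exists k, I' k st')).
- apply: (@reaches_seq _ _ _ 2 (N * (bcost (BLt (IVar x) n) + (T + 5)).+1
      + (bcost (BLt (IVar x) n)).+1) _ (I' 0%N)); last exact: leqnn.
    by exists 2, (State (upd (regs st) x 0%N) (memory st)); split=> //; exact: ExISet.
  move=> st' I0'; apply: (@reaches_while _ _ _ N (T + 5) _ I0') => k st1 [_ Ik] /=.
  have [-> ->] := IN _ _ Ik => kN; split=> //.
  have := @reaches_seq c (ISet x (IAdd (IVar x) (ICst 1))) st1 T 4 (T + 5) _ (I' k.+1)
    (Istep _ _ kN Ik).
  move=> H; apply: H; last lia.
  move=> st2 I2; exists 4, (State (upd (regs st2) x (regs st2 x + 1)%N) (memory st2)).
  by split=> //; exact: ExISet.
- rewrite /=; nia.
- move=> st' [/= + [k [kN Ik]]]; have [-> ->] := IN _ _ Ik.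
  by rewrite -leqNgt => Nk; have <- : k = N by lia.
Qed.

(** Code without loops and calls is executed symbolically: [run] computes its effect, and [ccost]
    bounds its time independently of the state by charging both branches of a test. *)
Fixpoint straight c : bool :=
  match c with
  | While _ _ | Call _ _ _ _ _ _ => false
  | Seq c1 c2 | If _ c1 c2 => straight c1 && straight c2
  | _ => true
  end.

Fixpoint run c st : state R :=
  match c with
  | ISet x e => State (upd (regs st) x (ieval st e)) (memory st)
  | RSet i e => State (regs st) (upd (memory st) (ieval st i) (reval st e))
  | Seq c1 c2 => run c2 (run c1 st)
  | If b c1 c2 => if beval st b then run c1 st else run c2 st
  | _ => st
  end.

Fixpoint ccost c : nat :=
  match c with
  | ISet x e => (icost e).+1
  | RSet i e => (icost i + rcost e).+1
  | Seq c1 c2 => (ccost c1 + ccost c2).+1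
  | If b c1 c2 => (bcost b + (ccost c1 + ccost c2)).+1
  | _ => 1
  end.

Lemma reaches_run c st T Q : straight c -> Q (run c st) -> (ccost c <= T)%N ->
  reaches c st T Q.
Proof.
move=> sc q cT; suff [t e tT] : exists2 t, exec c st t (run c st) & (t <= ccost c)%N.
  by exists t, (run c st); split=> //; exact: leq_trans cT.
elim: c st sc {Q q cT} => //=.
- by move=> st _; exists 1 => //; constructor.
- by move=> x e st _; eexists; first exact: ExISet.
- by move=> i e st _; eexists; first exact: ExRSet.
- move=> c1 IH1 c2 IH2 st /andP[/IH1-/(_ st)[t1 e1 T1] /IH2-/(_ (run c1 st))[t2 e2 T2]].
  by exists (t1 + t2).+1; [exact: ExSeq e1 e2|lia].
- move=> b c1 IH1 c2 IH2 st /andP[/IH1-/(_ st)[t1 e1 T1] /IH2-/(_ st)[t2 e2 T2]].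
  case: ifPn => bb.
    by exists (bcost b + t1).+1; [exact: ExIfT|lia].
  by exists (bcost b + t2).+1; [exact: ExIfF|lia].
Qed.

Lemma reaches_run_seq c1 c2 st T T' Q : straight c1 -> reaches c2 (run c1 st) T Q ->
  (ccost c1 + T < T')%N -> reaches (Seq c1 c2) st T' Q.
Proof.
move=> s1 H; apply: (@reaches_seq _ _ _ _ _ _ (fun st' => st' = run c1 st)).
  exact: reaches_run.
by move=> _ ->.
Qed.

Lemma reaches_seq_run c1 c2 st T T' Q : straight c2 ->
  reaches c1 st T (fun st' => Q (run c2 st')) ->
  (T + ccost c2 < T')%N -> reaches (Seq c1 c2) st T' Q.
Proof. by move=> s2 H; apply: (reaches_seq H) => st' q; exact: reaches_run. Qed.

Lemma reaches_call p args src len dst out st T T' Q :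
  reaches p (load [seq ieval st e | e <- args]
              [seq memory st (ieval st src + j)%N | j <- iota 0 (ieval st len)]) T
    (fun st1 => Q (State (regs st)
           (fun j => if (ieval st dst <= j < ieval st dst + out)%N
                     then memory st1 (j - ieval st dst)%N else memory st j))) ->
  (sumn [seq icost e | e <- args] + icost src + icost len + icost dst
           + ieval st len + T + out < T')%N ->
  reaches (Call p args src len dst out) st T' Q.
Proof.
move=> [t [st1 [e tT q]]] TT; eexists; eexists; split; [exact: ExCall e| |exact: q].
by lia.
Qed.

Definition mkstate (l : seq nat) (m : nat -> R) : state R := State (nth 0%N l) m.

Lemma upd_nth (l : seq nat) x v : upd (nth 0%N l) x v = nth 0%N (set_nth 0%N l x v).
Proof. by apply/funext => j; rewrite nth_set_nth. Qed.

Lemma upd_eq (m : nat -> R) i x j : j = i -> upd m i x j = x.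
Proof. by move=> ->; rewrite /upd eqxx. Qed.

Lemma upd_neq (m : nat -> R) i x j : j <> i -> upd m i x j = m j.
Proof. by move=> /eqP/negbTE; rewrite /upd => ->. Qed.

End Logic.

(* Real comparisons are booleans, on which lia would split uselessly. *)
Ltac nat_lia :=
  try match goal with R : realType |- _ => clear dependent R end; lia.

(** * The program *)

Section Program.
Variables (R : realType) (P : com R).

(* Registers: S, A, the size W of the real input, the loop counters s, a, s',
   and a flag telling whether some b_as' is at most beta. Scratch cells W + k:
     0: Rbar   1, 2: bisection bounds   3: sum of the projections over a
     4: b_a . pbar_sa   5, 6: output of P   8: beta   9: delta
     10 ...: b_a, then pbar_sa, then the computed values of the states
   Cells W + 8 to W + 9 + 2S are the contiguous input of P. *)
Definition cell k : iexpr := IAdd (IVar 2) (ICst k).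
Definition scalar k : rexpr R := RMem (cell k).
Definition size_sas := IMul (IMul (IVar 0) (IVar 1)) (IVar 0).
Definition index_sas :=
  IAdd (IMul (IAdd (IMul (IVar 3) (IVar 1)) (IVar 4)) (IVar 0)) (IVar 5).
Definition reward_base := IAdd (ICst 3) (IVar 0).
Definition nominal_base := IAdd reward_base size_sas.
Definition b_cell := IAdd (cell 10) (IVar 5).
Definition q_cell := IAdd (IAdd (cell 10) (IVar 0)) (IVar 5).
Definition out_cell := IAdd (IAdd (cell 10) (IAdd (IVar 0) (IVar 0))) (IVar 3).

Definition load_body : com R :=
  Seq (RSet b_cell (RAdd (RMem (IAdd reward_base index_sas))
         (RMul (RMem (ICst 0)) (RMem (IAdd (ICst 3) (IVar 5))))))
  (Seq (RSet q_cell (RMem (IAdd nominal_base index_sas)))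
  (Seq (RSet (cell 4) (RAdd (scalar 4) (RMul (RMem b_cell) (RMem q_cell))))
    (If (BLe (RMem b_cell) (scalar 8)) (ISet 6 (ICst 1)) Skip))).

(** A trivial projection adds 0; an infeasible one adds the budget plus 1, which makes the test
    fail. Otherwise the upper bound returned by [P] is added, so that a passed test is reliable. *)
Definition projection_call : com R :=
  If (BLe (scalar 4) (scalar 8)) Skip
    (If (BLt (ICst 0) (IVar 6))
      (Seq (Call P [:: IVar 0] (cell 8) (IAdd (ICst 2) (IAdd (IVar 0) (IVar 0)))
              (cell 5) 2)
           (RSet (cell 3) (RAdd (scalar 3) (scalar 6))))
      (RSet (cell 3) (RAdd (scalar 3) (RAdd (RMem (ICst 1)) (RCst 1))))).

Definition action_body : com R :=
  Seq (Seq (RSet (cell 4) (RCst 0)) (ISet 6 (ICst 0)))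
  (Seq (For 5 (IVar 0) load_body) projection_call).

Definition bisect_body : com R :=
  Seq (Seq (RSet (cell 8) (RDiv (RAdd (scalar 1) (scalar 2)) (RCst 2)))
           (RSet (cell 3) (RCst 0)))
  (Seq (For 4 (IVar 1) action_body)
       (If (BLe (scalar 3) (RMem (ICst 1)))
           (RSet (cell 2) (scalar 8)) (RSet (cell 1) (scalar 8)))).

(** Halving stops at a length below [eps / 2]; inexact tests may cost another [eps / 2], so the
    upper end is accurate to [eps]. *)
Definition state_body : com R :=
  Seq (Seq (RSet (cell 1) (RCst 0)) (RSet (cell 2) (scalar 0)))
  (Seq (While (BLe (RDiv (RMem (ICst 2)) (RCst 2)) (RSub (scalar 2) (scalar 1)))
          bisect_body)
       (RSet out_cell (scalar 2))).

Definition max_body : com R :=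
  If (BLe (RMem (IAdd reward_base (IVar 5))) (scalar 0)) Skip
     (RSet (cell 0) (RMem (IAdd reward_base (IVar 5)))).

(** Results wait in scratch cells and are copied to the first cells at the end, since those hold
    input until all states are done. *)
Definition bellman_prog : com R :=
  Seq (Seq (ISet 2 (IAdd nominal_base size_sas))
         (Seq (ISet 6 (ICst 0)) (RSet (cell 0) (RCst 0))))
  (Seq (For 5 size_sas max_body)
  (Seq (Seq (RSet (cell 0) (RDiv (scalar 0) (RSub (RCst 1) (RMem (ICst 0)))))
            (RSet (cell 9) (RDiv (RMul (RMem (ICst 2)) (RMem (ICst 1)))
               (RAdd (RMul (RMul (RCst 2) (RNat (IVar 1))) (scalar 0))
                     (RMul (RNat (IVar 1)) (RMem (ICst 2)))))))
  (Seq (For 3 (IVar 0) state_body)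
       (For 3 (IVar 0) (RSet (IVar 3) (RMem out_cell)))))).

(* An opaque name for the end of the input, which spares lia its nonlinear
   definition in all reasoning about disjoint addresses. *)
Definition input_size (S A W : nat) : Prop :=
  W = (3 + S + S * A * S + S * A * S)%N.

Lemma flat_index_lt S A s a i : (s < S)%N -> (a < A)%N -> (i < S)%N ->
  ((s * A + a) * S + i < S * A * S)%N.
Proof.
move=> sS aA iS; have h1 : (s * A + a < S * A)%N.
  by apply: (@leq_trans (s.+1 * A)); [rewrite mulSn; lia|rewrite leq_mul2r sS orbT].
apply: (@leq_trans ((s * A + a).+1 * S)); first by rewrite mulSn; lia.
by rewrite leq_mul2r h1 orbT.
Qed.

(** * Correctness and running time of the program for an abstract oracle *)

Section Correctness.
Variables (S A K W : nat) (m0 : nat -> R).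
Hypotheses (HW : input_size S A W) (W_ge : (3 + S <= W)%N).
Hypotheses (S0 : (0 < S)%N) (A0 : (0 < A)%N) (SK : (2 + S + S <= K)%N).
Local Notation disc := (m0 0%N).
Local Notation kappa := (m0 1%N).
Local Notation eps := (m0 2%N).
Let idx s a i := ((s * A + a) * S + i)%N.
Let bn s a i := m0 (3 + S + idx s a i)%N + disc * m0 (3 + i)%N.
Let qn s a i := m0 (3 + S + S * A * S + idx s a i)%N.
Variable rmax : R.
Hypotheses (rmax0 : 0 <= rmax)
  (rmax_ub : forall j, (j < S * A * S)%N -> m0 (3 + S + j)%N <= rmax)
  (rmax_least : forall x, 0 <= x ->
     (forall j, (j < S * A * S)%N -> m0 (3 + S + j)%N <= x) -> rmax <= x).
Let Rb := rmax / (1 - disc).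
Let delta := eps * kappa / (2 * A%:R * Rb + A%:R * eps).

(* [spec s a beta u]: adding u to the tested sum on behalf of action a is sound. *)
Variable spec : nat -> nat -> R -> R -> Prop.
Hypothesis oracle : forall s a beta, (s < S)%N -> (a < A)%N -> 0 <= beta ->
  (exists2 i, (i < S)%N & bn s a i <= beta) ->
  beta < \sum_(i < S) bn s a i * qn s a i ->
  reaches P (load [:: S] ([:: beta; delta] ++ mkseq (bn s a) S ++ mkseq (qn s a) S))
    K (fun st => spec s a beta (memory st 1%N)).
Hypothesis spec_trivial : forall s a beta, (s < S)%N -> (a < A)%N ->
  \sum_(i < S) bn s a i * qn s a i <= beta -> spec s a beta 0.
Hypothesis spec_infeasible : forall s a beta, (s < S)%N -> (a < A)%N ->
  (forall i, (i < S)%N -> beta < bn s a i) -> spec s a beta (kappa + 1).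

(** [J] stands for the Bellman values; the game enters through their bounds and the decision rule
    below. *)
Variable J : nat -> R.
Hypothesis J_bounds : forall s, (s < S)%N -> 0 <= J s <= Rb.
Hypothesis J_decision : forall s beta u, (s < S)%N -> 0 <= beta < Rb ->
  (forall a, (a < A)%N -> spec s a beta (u a)) ->
  if \sum_(a < A) u a <= kappa then J s <= beta else beta - eps / 2 <= J s.
Hypothesis eps0 : 0 < eps.
Variable N : nat.
Hypothesis N_large : Rb / 2 ^+ N < eps / 2.

Definition same_input (m : nat -> R) := forall j, (j < W)%N -> m j = m0 j.

Lemma load_loop s a (m : nat -> R) i0 : (s < S)%N -> (a < A)%N -> same_input m ->
  m (W + 4)%N = 0 ->
  reaches (For 5 (IVar 0) load_body) (mkstate [:: S; A; W; s; a; i0; 0%N] m)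
    (S * 200 + 20)
    (fun st => exists f m', [/\ st = mkstate [:: S; A; W; s; a; S; f] m',
      forall j, (j < W + 10)%N && (j != W + 4)%N || (W + 10 + S + S <= j)%N ->
         m' j = m j,
      forall i, (i < S)%N -> m' (W + 10 + i)%N = bn s a i
                          /\ m' (W + 10 + S + i)%N = qn s a i,
      m' (W + 4)%N = \sum_(i < S) bn s a i * qn s a i &
      (0 < f)%N <-> exists2 i, (i < S)%N & bn s a i <= m (W + 8)%N]).
Proof.
move=> sS aA sm m4.
pose I k st := exists f m', [/\ st = mkstate [:: S; A; W; s; a; k; f] m',
      forall j, (j < W + 10)%N && (j != W + 4)%N || (W + 10 + S + S <= j)%N ->
         m' j = m j,
      forall i, (i < k)%N -> m' (W + 10 + i)%N = bn s a i
                          /\ m' (W + 10 + S + i)%N = qn s a i,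
      m' (W + 4)%N = \sum_(i < k) bn s a i * qn s a i &
      (0 < f)%N <-> exists2 i, (i < k)%N & bn s a i <= m (W + 8)%N].
apply: (@reaches_conseq _ _ _ (S * (ccost load_body + 1 + 8) + 1 + 8) _ (I S)) => //.
- apply: (@reaches_for _ _ _ _ _ _ I).
  + exists 0%N, m; split=> //; first by rewrite /= upd_nth.
      by rewrite big_ord0.
    by split=> // -[].
  + by move=> k st [f [m' [-> _ _ _ _]]].
  + move=> k st kS [f [m' [-> fr bq dot fl]]]; apply: (reaches_run _ _ (leqnn _)) => //.
    have [rW qW] : (3 + S + ((s * A + a) * S + k) < W)%N /\
                   (3 + S + S * A * S + ((s * A + a) * S + k) < W)%N.
      by have := flat_index_lt sS aA kS; move: (HW); rewrite /input_size => ->; nat_lia.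
    have fr' j : (j < W)%N -> m' j = m0 j.
      by move=> jW; rewrite fr ?sm //; nat_lia.
    rewrite /load_body /=.
    set x := m' (3 + S + _)%N + _.
    have Ex : x = bn s a k by rewrite /x /bn /idx !fr' //; nat_lia.
    rewrite [upd m' (W + 10 + k)%N x _]upd_neq; last nat_lia.
    rewrite [X in upd (upd m' _ x) _ X]fr'; last nat_lia.
    have Ey : m0 (3 + S + S * A * S + ((s * A + a) * S + k))%N = qn s a k by [].
    rewrite Ey {}Ex {x}.
    set m1 := upd (upd m' _ _) _ _.
    have m1b : m1 (W + 10 + k)%N = bn s a k.
      by rewrite /m1 upd_neq ?upd_eq; nat_lia || exact: erefl.
    have m1q : m1 (W + 10 + S + k)%N = qn s a k by rewrite /m1 upd_eq.
    have m1o j : j <> (W + 10 + k)%N -> j <> (W + 10 + S + k)%N -> m1 j = m' j.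
      by move=> *; rewrite /m1 !upd_neq.
    rewrite m1b m1q [m1 (W + 4)%N]m1o; [|nat_lia|nat_lia].
    rewrite dot.
    set m2 := upd m1 _ _.
    have m2o j : j <> (W + 4)%N -> m2 j = m1 j by move=> *; rewrite /m2 upd_neq.
    have -> : m2 (W + 8)%N = m (W + 8)%N.
      rewrite m2o ?m1o ?fr //; nat_lia.
    have -> : m2 (W + 10 + k)%N = bn s a k by rewrite m2o //; nat_lia.
    have stepI f' : ((0 < f')%N <-> exists2 i, (i < k.+1)%N & bn s a i <= m (W + 8)%N) ->
        I k.+1 (State (nth 0%N [:: S; A; W; s; a; k.+1; f']) m2).
      move=> Hf; exists f', m2; split=> //.
      * move=> j Hj; rewrite m2o ?m1o ?fr //; nat_lia.
      * move=> i; rewrite ltnS leq_eqVlt => /orP[/eqP->|ik].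
          by rewrite !m2o //; nat_lia.
        have [<- <-] := bq _ ik.
        by rewrite !m2o ?m1o //; nat_lia.
      * by rewrite /m2 upd_eq // big_ord_recr.
    case: ifPn => Hb; rewrite /= !upd_nth /= addn1; apply: stepI.
      by split=> // _; exists k.
    split=> [/fl[i ik ib]|[i]]; first by exists i => //; nat_lia.
    rewrite ltnS leq_eqVlt => /orP[/eqP->|ik ib]; first by rewrite (negbTE Hb).
    by apply/fl; exists i.
- rewrite /=; nia.
Qed.

(** [K] bounds the call as well as [2 + S + S], so a multiple of [K] also pays for filling and
    copying the argument cells. *)
Lemma action_step s a (m : nat -> R) i0 f0 : (s < S)%N -> (a < A)%N ->
  same_input m -> 0 <= m (W + 8)%N -> m (W + 9)%N = delta ->
  reaches action_body (mkstate [:: S; A; W; s; a; i0; f0] m) (1000 * K)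
    (fun st => exists i f m' u, [/\ st = mkstate [:: S; A; W; s; a; i; f] m',
      forall j, (j < W + 10)%N && ~~ (W + 3 <= j < W + 7)%N || (W + 10 + S + S <= j)%N ->
         m' j = m j,
      m' (W + 3)%N = m (W + 3)%N + u &
      spec s a (m (W + 8)%N) u]).
Proof.
move=> sS aA sm beta0 mdelta; set Post := (X in reaches _ _ _ X).
apply: (@reaches_run_seq _ _ _ _ (500 * K)); [by []| |rewrite /=; nat_lia].
rewrite /= !upd_nth /=.
apply: (@reaches_seq _ _ _ _ _ (200 * K)); [apply: load_loop => //| | ].
- by move=> j jW; rewrite upd_neq ?sm //; nat_lia.
- by rewrite upd_eq.
- move=> _ [f [m1 [-> fr bq dot fl]]]; rewrite upd_neq in fl; last nat_lia.
  have {}fr j : (j < W + 10)%N && (j != W + 4)%N || (W + 10 + S + S <= j)%N ->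
      m1 j = m j by move=> Hj; rewrite fr // upd_neq //; nat_lia.
  have m18 : m1 (W + 8)%N = m (W + 8)%N by apply: fr; nat_lia.
  apply: (@reaches_if _ _ _ _ _ (100 * K)).
  + rewrite /= m18 dot => Hdot.
    apply: reaches_run => //; last by rewrite /=; nat_lia.
    exists S, f, m1, 0; split=> //.
    * by move=> j Hj; apply: fr; nat_lia.
    * by rewrite addr0 fr //; nat_lia.
    * exact: spec_trivial.
  + rewrite /= m18 dot -ltNge => Hdot.
    apply: (@reaches_if _ _ _ _ _ (50 * K)); last by rewrite /=; nat_lia.
    * rewrite /= => /fl feas.
      apply: (@reaches_seq_run _ _ _ _ (20 * K)) => //; last by rewrite /=; nat_lia.
      apply: (@reaches_call _ _ _ _ _ _ _ _ K); last by rewrite /=; nat_lia.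
      rewrite /=.
      have -> : [seq m1 (W + 8 + j)%N | j <- iota 2 (S + S)] =
          mkseq (bn s a) S ++ mkseq (qn s a) S.
        rewrite iotaD map_cat (iotaDl 2 0 S).
        rewrite (_ : iota (2 + S) S = map (addn (2 + S)) (iota 0 S)); last first.
          by rewrite -iotaDl addn0.
        rewrite -!map_comp.
        congr (_ ++ _); apply/eq_in_map => i; rewrite mem_iota /= => iS.
          have [<- _] := bq i iS; congr m1; nat_lia.
        have [_ <-] := bq i iS; congr m1; nat_lia.
      rewrite addn0 m18 addn1 -addnS fr ?mdelta; last nat_lia.
      apply: (reaches_conseq (oracle sS aA beta0 feas Hdot)) => // st1 Hspec.
      set m2 := (fun j : nat => _).
      have m2o j : (j < W + 5)%N || (W + 7 <= j)%N -> m2 j = m1 j.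
        by move=> Hj; rewrite /m2; case: ifP => //; nat_lia.
      have m26 : m2 (W + 6)%N = memory st1 1%N.
        rewrite /m2; case: ifP => [_|]; last nat_lia.
        by congr (memory st1); nat_lia.
      rewrite -/(m2 (W + 3)%N) -/(m2 (W + 6)%N) m26 m2o; last nat_lia.
      exists S, f; eexists; exists (memory st1 1%N); split=> //.
      - by move=> j Hj; rewrite upd_neq ?m2o ?fr //; nat_lia.
      - by rewrite upd_eq // fr //; nat_lia.
    * rewrite /= => Hf; apply: reaches_run => //; last by rewrite /=; nat_lia.
      rewrite /= [m1 1%N]fr ?[m 1%N]sm; [|nat_lia|nat_lia].
      exists S, f; eexists; exists (kappa + 1); split=> //.
      - by move=> j Hj; rewrite upd_neq ?fr //; nat_lia.
      - by rewrite upd_eq // fr //; nat_lia.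
      - apply: spec_infeasible => // i iS; rewrite ltNge; apply/negP => bi.
        by move: Hf; rewrite (_ : (0 < f)%N) //; apply/fl; exists i.
  + rewrite /=; nat_lia.
- rewrite /=; nat_lia.
Qed.

(** The ghost sequence [u] records what each action has added, the form in which [J_decision] judges
    the test. *)
Lemma action_loop s (m : nat -> R) a0 i0 f0 : (s < S)%N ->
  same_input m -> 0 <= m (W + 8)%N -> m (W + 9)%N = delta -> m (W + 3)%N = 0 ->
  reaches (For 4 (IVar 1) action_body) (mkstate [:: S; A; W; s; a0; i0; f0] m)
    (1100 * (A * K))
    (fun st => exists i f m' (u : nat -> R), [/\ st = mkstate [:: S; A; W; s; A; i; f] m',
      forall j, (j < W + 10)%N && ~~ (W + 3 <= j < W + 7)%N || (W + 10 + S + S <= j)%N ->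
         m' j = m j,
      m' (W + 3)%N = \sum_(a < A) u a &
      forall a, (a < A)%N -> spec s a (m (W + 8)%N) (u a)]).
Proof.
move=> sS sm beta0 mdelta m3.
pose I k st := exists i f m' (u : nat -> R), [/\ st = mkstate [:: S; A; W; s; k; i; f] m',
      forall j, (j < W + 10)%N && ~~ (W + 3 <= j < W + 7)%N || (W + 10 + S + S <= j)%N ->
         m' j = m j,
      m' (W + 3)%N = \sum_(a < k) u a &
      forall a, (a < k)%N -> spec s a (m (W + 8)%N) (u a)].
apply: (reaches_conseq (@reaches_for _ _ _ _ A (1000 * K) I _ _ _ _)) => //.
- exists i0, f0, m, (fun=> 0); split=> //; first by rewrite /= upd_nth.
  by rewrite big_ord0.
- by move=> k st [i [f [m' [u [-> _ _ _]]]]].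
- move=> k st kA [i [f [m1 [u [-> fr sum Hu]]]]].
  have m18 : m1 (W + 8)%N = m (W + 8)%N by apply: fr; nat_lia.
  have sm1 : same_input m1 by move=> j jW; rewrite fr ?sm //; nat_lia.
  have := @action_step s k m1 i f sS kA sm1; rewrite m18 => /(_ beta0).
  rewrite fr ?mdelta; last nat_lia.
  move=> /(_ erefl) H; apply: (reaches_conseq H) => //.
  move=> _ [i' [f' [m2 [x [-> fr2 sum2 Hx]]]]].
  exists i', f', m2, (upd u k x); split=> /=.
  + by rewrite upd_nth addn1.
  + by move=> j Hj; rewrite fr2 ?fr.
  + rewrite sum2 sum big_ord_recr /= upd_eq //; congr (_ + _).
    by apply: eq_bigr => a _; rewrite upd_neq //; have := ltn_ord a; nat_lia.
  + move=> a; rewrite ltnS leq_eqVlt => /orP[/eqP->|ak]; first by rewrite upd_eq.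
    by rewrite upd_neq; [exact: Hu|nat_lia].
- have := leq_pmulr A (ltn_trans _ SK); rewrite /=; nia.
Qed.

(** Only the lower end carries the slack [eps / 2]: a passed test is right, whereas a failed one may
    be due to the inaccuracy of the projections. *)
Lemma bisect_step s (m : nat -> R) a0 i0 f0 : (s < S)%N -> same_input m ->
  m (W + 9)%N = delta -> 0 <= m (W + 1)%N < m (W + 2)%N -> m (W + 2)%N <= Rb ->
  m (W + 1)%N - eps / 2 <= J s <= m (W + 2)%N ->
  reaches bisect_body (mkstate [:: S; A; W; s; a0; i0; f0] m) (1200 * (A * K))
    (fun st => exists a i f m', [/\ st = mkstate [:: S; A; W; s; a; i; f] m',
      forall j, (j <= W)%N || (j == W + 9)%N || (W + 10 + S + S <= j)%N ->
         m' j = m j,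
      m' (W + 2)%N - m' (W + 1)%N = (m (W + 2)%N - m (W + 1)%N) / 2,
      m' (W + 1)%N - eps / 2 <= J s <= m' (W + 2)%N &
      [&& 0 <= m' (W + 1)%N, m' (W + 1)%N <= m' (W + 2)%N & m' (W + 2)%N <= Rb]]).
Proof.
move=> sS sm mdelta /andP[lo0 lohi] hiR /andP[Jlo Jhi]; set Post := (X in reaches _ _ _ X).
have AK : (4 <= A * K)%N by rewrite (leq_trans _ (leq_pmull K A0)) //; nat_lia.
apply: (@reaches_run_seq _ _ _ _ (1150 * (A * K))); [by []| |rewrite /=; nat_lia].
rewrite /=; set beta := (_ / 2).
have Ebeta : beta = (m (W + 1)%N + m (W + 2)%N) / 2 by [].
set m1 := upd (upd _ _ _) _ _.
have m1o j : j <> (W + 8)%N -> j <> (W + 3)%N -> m1 j = m j.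
  by move=> *; rewrite /m1 !upd_neq.
have m18 : m1 (W + 8)%N = beta by rewrite /m1 upd_neq ?upd_eq //; nat_lia.
apply: (@reaches_seq _ _ _ _ _ (20 * (A * K))).
- apply: action_loop => //.
  + by move=> j jW; rewrite m1o ?sm //; nat_lia.
  + by rewrite m18 Ebeta; lra.
  + by rewrite m1o //; nat_lia.
  + by rewrite /m1 upd_eq.
- move=> _ [i [f [m2 [u [-> fr sum Hu]]]]]; rewrite m18 in Hu.
  have beta01 : 0 <= beta < Rb by rewrite Ebeta; lra.
  have Hdec := J_decision sS beta01 Hu.
  have [m2k m28] : m2 1%N = kappa /\ m2 (W + 8)%N = beta.
    by rewrite !fr ?m18 ?m1o ?sm //; nat_lia.
  have [m21 m22] : m2 (W + 1)%N = m (W + 1)%N /\ m2 (W + 2)%N = m (W + 2)%N.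
    by rewrite !fr ?m1o //; nat_lia.
  apply: reaches_run => //; last by rewrite /=; nat_lia.
  rewrite /= sum m2k m28; move: Hdec; case: ifP => _ HJ.
  + have e1 : upd m2 (W + 2)%N beta (W + 1)%N = m (W + 1)%N.
      by rewrite upd_neq //; nat_lia.
    have e2 : upd m2 (W + 2)%N beta (W + 2)%N = beta by rewrite upd_eq.
    exists A, i, f, (upd m2 (W + 2)%N beta); split; rewrite ?e1 ?e2 //.
    * by move=> j Hj; rewrite upd_neq ?fr ?m1o //; nat_lia.
    * rewrite Ebeta; lra.
    * by rewrite Jlo.
    * by rewrite Ebeta; apply/and3P; split; lra.
  + have e2 : upd m2 (W + 1)%N beta (W + 2)%N = m (W + 2)%N.
      by rewrite upd_neq //; nat_lia.
    have e1 : upd m2 (W + 1)%N beta (W + 1)%N = beta by rewrite upd_eq.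
    exists A, i, f, (upd m2 (W + 1)%N beta); split; rewrite ?e1 ?e2 //.
    * by move=> j Hj; rewrite upd_neq ?fr ?m1o //; nat_lia.
    * rewrite Ebeta; lra.
    * by rewrite HJ.
    * by rewrite Ebeta; apply/and3P; split; lra.
- rewrite /=; nat_lia.
Qed.

Lemma state_step s (m : nat -> R) a0 i0 f0 : (s < S)%N -> same_input m ->
  m W = Rb -> m (W + 9)%N = delta ->
  reaches state_body (mkstate [:: S; A; W; s; a0; i0; f0] m)
    (1400 * (N.+1 * (A * K)))
    (fun st => exists a i f m', [/\ st = mkstate [:: S; A; W; s; a; i; f] m',
      forall j, (j <= W)%N || (j == W + 9)%N ||
                (W + 10 + S + S <= j)%N && (j != W + 10 + S + S + s)%N ->
         m' j = m j &
      `|m' (W + 10 + S + S + s)%N - J s| <= eps]).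
Proof.
move=> sS sm mR mdelta; set Post := (X in reaches _ _ _ X).
have AK : (4 <= A * K)%N by rewrite (leq_trans _ (leq_pmull K A0)) //; nat_lia.
have /andP[J0 JR] := J_bounds sS.
have eps_gt0 : 0 < eps := eps0.
apply: (@reaches_run_seq _ _ _ _ (1350 * (N.+1 * (A * K)))); [by []| |rewrite /=; nat_lia].
rewrite /= !addn0.
set m1 := upd (upd _ _ _) _ _.
have m1o j : j <> (W + 1)%N -> j <> (W + 2)%N -> m1 j = m j.
  by move=> *; rewrite /m1 !upd_neq.
have m11 : m1 (W + 1)%N = 0 by rewrite /m1 upd_neq ?upd_eq //; nat_lia.
have m12 : m1 (W + 2)%N = Rb by rewrite /m1 upd_eq // upd_neq //; nat_lia.
pose I k st := exists a i f m', [/\ st = mkstate [:: S; A; W; s; a; i; f] m',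
      forall j, (j <= W)%N || (j == W + 9)%N || (W + 10 + S + S <= j)%N ->
         m' j = m j,
      m' (W + 2)%N - m' (W + 1)%N = Rb / 2 ^+ k,
      m' (W + 1)%N - eps / 2 <= J s <= m' (W + 2)%N &
      [&& 0 <= m' (W + 1)%N, m' (W + 1)%N <= m' (W + 2)%N & m' (W + 2)%N <= Rb]].
apply: (@reaches_seq_run _ _ _ _ (1300 * (N.+1 * (A * K)))) => //; last by rewrite /=; nat_lia.
apply: (reaches_conseq (@reaches_while _ _ _ _ N (1200 * (A * K)) I _ _)).
- exists a0, i0, f0, m1; split=> //.
  + by move=> j Hj; rewrite m1o //; nat_lia.
  + by rewrite m11 m12 expr0 divr1 subr0.
  + rewrite m11 m12 JR andbT sub0r (le_trans _ J0) // oppr_le0.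
    by rewrite divr_ge0 // ltW.
  + by rewrite m11 m12 !lexx (le_trans J0).
- move=> k st [a [i [f [m2 [-> fr gap HJ /and3P[lo0 lohi hiR]]]]]] /=.
  have -> : m2 2%N = eps by rewrite fr ?sm //; nat_lia.
  rewrite gap => Hgap; split.
    (* From [N] halvings on, the gap is below [eps / 2] and the loop test fails. *)
    rewrite ltnNge; apply/negP => Nk.
    have : Rb / 2 ^+ k < Rb / 2 ^+ k; last by rewrite ltxx.
    apply: lt_le_trans Hgap; apply: le_lt_trans N_large.
    rewrite ler_wpM2l ?(le_trans J0) // lef_pV2 ?posrE ?exprn_gt0 //.
    by rewrite ler_eXn2l // ltr1n.
  apply: (reaches_conseq (bisect_step _ _ _ _ _ _ _ _ _)) => //.
  + by move=> j jW; rewrite fr ?sm //; nat_lia.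
  + by rewrite fr //; nat_lia.
  + by rewrite lo0 /= -subr_gt0 gap; lra.
  + move=> _ [a' [i' [f' [m3 [-> fr3 gap3 HJ3 H3]]]]].
    exists a', i', f', m3; split=> //; first by move=> j Hj; rewrite fr3 ?fr.
    by rewrite gap3 gap exprSr invfM mulrA.
- rewrite /=; nia.
- move=> st' [/= Hb [k [a [i [f [m2 [Est fr gap HJ H2]]]]]]].
  move: Hb; rewrite Est /= -ltNge.
  have -> : m2 2%N = eps by rewrite fr ?sm //; nat_lia.
  move=> Hb; exists a, i, f; eexists; split=> //.
  + by move=> j Hj; rewrite upd_neq ?fr //; nat_lia.
  + rewrite upd_eq; last nat_lia.
    (* The final gap and the slack of the lower end, [eps / 2] each, add up to [eps]. *)
    rewrite ler_norml; lra.
Qed.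

Lemma max_loop (m : nat -> R) : (forall j, j <> W -> m j = m0 j) -> m W = 0 ->
  reaches (For 5 size_sas max_body) (mkstate [:: S; A; W; 0; 0; 0; 0] m)
    (60 * (S * A * S) + 20)
    (fun st => exists m', [/\ st = mkstate [:: S; A; W; 0; 0; S * A * S; 0]%N m',
      forall j, j <> W -> m' j = m0 j & m' W = rmax]).
Proof.
move=> fr m1.
pose I k st := exists m', [/\ st = mkstate [:: S; A; W; 0; 0; k; 0]%N m',
      forall j, j <> W -> m' j = m0 j, 0 <= m' W <= rmax &
      forall j, (j < k)%N -> m0 (3 + S + j)%N <= m' W].
apply: (reaches_conseq (@reaches_for _ _ _ _ (S * A * S) (ccost max_body) I _ _ _ _)).
- by exists m; split=> //=; rewrite ?upd_nth // m1 lexx.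
- by move=> k st [m' [-> _ _ _]].
- move=> k st kD [m' [-> fr' /andP[x0 xr] Hx]]; apply: reaches_run => //.
  have kW : (3 + S + k < W)%N by move: (HW); rewrite /input_size => ->; nat_lia.
  rewrite /= addn0 fr'; last nat_lia.
  case: ifPn => Hk /=; rewrite upd_nth /= addn1.
    exists m'; split=> //; first by rewrite x0.
    by move=> j; rewrite ltnS leq_eqVlt => /orP[/eqP->|/Hx].
  rewrite -ltNge in Hk.
  exists (upd m' W (m0 (3 + S + k)%N)); split=> //.
  + by move=> j Hj; rewrite upd_neq ?fr'.
  + by rewrite upd_eq // (le_trans x0 (ltW Hk)) rmax_ub.
  + move=> j; rewrite upd_eq // ltnS leq_eqVlt => /orP[/eqP->//|/Hx].
    by move=> /le_trans; apply; exact: ltW.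
- by rewrite /=; nat_lia.
- move=> st [m' [-> fr' /andP[x0 xr] Hx]]; exists m'; split=> //.
  by apply/eqP; rewrite eq_le xr rmax_least.
Qed.

Lemma state_loop (m : nat -> R) a0 i0 f0 : same_input m ->
  m W = Rb -> m (W + 9)%N = delta ->
  reaches (For 3 (IVar 0) state_body) (mkstate [:: S; A; W; 0; a0; i0; f0]%N m)
    (1500 * (S * (N.+1 * (A * K))))
    (fun st => exists a i f m', st = mkstate [:: S; A; W; S; a; i; f] m' /\
      forall s, (s < S)%N -> `|m' (W + 10 + S + S + s)%N - J s| <= eps).
Proof.
move=> sm mR mdelta.
pose I k st := exists a i f m', [/\ st = mkstate [:: S; A; W; k; a; i; f] m',
      forall j, (j <= W)%N || (j == W + 9)%N -> m' j = m j &
      forall s, (s < k)%N -> `|m' (W + 10 + S + S + s)%N - J s| <= eps].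
apply: (reaches_conseq (@reaches_for _ _ _ _ S (1400 * (N.+1 * (A * K))) I _ _ _ _)).
- by exists a0, i0, f0, m; split=> //=; rewrite upd_nth.
- by move=> k st [a [i [f [m' [-> _ _]]]]].
- move=> k st kS [a [i [f [m1 [-> fr Hs]]]]].
  apply: (reaches_conseq (state_step _ _ _ kS _ _ _)) => //.
  + by move=> j jW; rewrite fr ?sm //; nat_lia.
  + by rewrite fr //; nat_lia.
  + by rewrite fr //; nat_lia.
  + move=> _ [a' [i' [f' [m2 [-> fr2 Hk]]]]].
    exists a', i', f', m2; split=> /=.
    * by rewrite upd_nth addn1.
    * by move=> j Hj; rewrite fr2 ?fr //; nat_lia.
    * move=> s; rewrite ltnS leq_eqVlt => /orP[/eqP->//|sk].
      by rewrite fr2 ?Hs //; nat_lia.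
- have AK : (4 <= A * K)%N by rewrite (leq_trans _ (leq_pmull K A0)) //; nat_lia.
  have T4 : (4 <= N.+1 * (A * K))%N.
    by rewrite (leq_trans AK) // leq_pmull.
  have ST : (S * 4 <= S * (N.+1 * (A * K)))%N by rewrite leq_mul2l T4 orbT.
  move: T4 ST; rewrite /=; move: (N.+1 * (A * K))%N => T; nat_lia.
- by move=> st [a [i [f [m' [-> _ H]]]]]; exists a, i, f, m'.
Qed.

Lemma bellman_prog_correct :
  reaches bellman_prog (mkstate [:: S; A] m0) (2000 * (S * (N.+1 * (A * K))))
    (fun st => forall s, (s < S)%N -> `|memory st s - J s| <= eps).
Proof.
set Post := (X in reaches _ _ _ X).
have AK : (4 <= A * K)%N by rewrite (leq_trans _ (leq_pmull K A0)) //; nat_lia.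
have T4 : (A * K <= N.+1 * (A * K))%N by rewrite leq_pmull.
have ST : (S * (A * K) <= S * (N.+1 * (A * K)))%N by rewrite leq_mul2l T4 orbT.
(* Since [S <= K], the initial scan of the rewards is absorbed by the time of the bisections. *)
have SS : (S * A * S <= S * (A * K))%N.
  by rewrite -mulnA !leq_mul2l; apply/orP; right; apply/orP; right; nat_lia.
have S4 : (S * 4 <= S * (A * K))%N by rewrite leq_mul2l AK orbT.
set T := (S * (N.+1 * (A * K)))%N in ST *; rewrite -/T.
apply: (@reaches_run_seq _ _ _ _ (1950 * T)); [by []| |rewrite /=; nat_lia].
rewrite /= !upd_nth /= -HW addn0.
apply: (@reaches_seq _ _ _ _ _ (1800 * T)).
- by apply: max_loop => [j jW|]; [rewrite upd_neq|rewrite upd_eq].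
- move=> _ [m1 [-> fr1 m1W]].
  apply: (@reaches_run_seq _ _ _ _ (1750 * T)); [by []| |rewrite /=; nat_lia].
  rewrite /= addn0 m1W fr1; last nat_lia.
  set m2 := upd m1 W _; have m2o j : j <> W -> m2 j = m0 j.
    by move=> Hj; rewrite /m2 upd_neq ?fr1.
  have m2W : m2 W = Rb by rewrite /m2 upd_eq.
  rewrite m2W !m2o; [|nat_lia|nat_lia].
  rewrite -/delta.
  apply: (@reaches_seq _ _ _ _ _ (200 * T)).
  + apply: state_loop.
    * by move=> j jW; rewrite upd_neq ?m2o //; nat_lia.
    * by rewrite upd_neq //; nat_lia.
    * by rewrite upd_eq.
  + move=> _ [a [i [f [m3 [-> Hm3]]]]].
    (* Copying reads from address [W] on and writes below [S], so no result is overwritten before it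
       is read. *)
    pose I k st := exists m', [/\ st = mkstate [:: S; A; W; k; a; i; f] m',
      forall j, (W <= j)%N -> m' j = m3 j &
      forall s, (s < k)%N -> `|m' s - J s| <= eps].
    apply: (reaches_conseq (@reaches_for _ _ _ _ S 20 I _ _ _ _)).
    * by exists m3; split=> //=; rewrite upd_nth.
    * by move=> k st [m' [-> _ _]].
    * move=> k st kS [m' [-> fr Hs]]; apply: reaches_run => //=.
      eexists; split; first by rewrite upd_nth addn1.
        by move=> j Wj; rewrite upd_neq ?fr //; nat_lia.
      move=> s; rewrite ltnS leq_eqVlt => /orP[/eqP->|sk].
        by rewrite upd_eq // !addnA fr ?Hm3 //; nat_lia.
      by rewrite upd_neq ?Hs //; nat_lia.
    * by rewrite /=; nat_lia.
    * by move=> st [m' [-> _ Hs]].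
  + by rewrite -/T; nat_lia.
- by nat_lia.
Qed.

End Correctness.
End Program.

(** * Specialization to robust MDPs *)

Section RewardBound.
Variables (R : realType) (phi : R -> R).
Hypothesis hphi : divergence_function phi.
Variables (S A : nat) (M : rmdp R S A).
Hypothesis A0 : (0 < A)%N.

Definition max_reward : R :=
  \big[Num.max/0]_(s < S) \big[Num.max/0]_(a < A) \big[Num.max/0]_(s' < S)
     reward M s a s'.

Lemma max_reward_ge0 : 0 <= max_reward.
Proof. exact: bigmax_ge_id. Qed.

Lemma reward_le_max s a s' : reward M s a s' <= max_reward.
Proof.
apply: le_trans (le_bigmax _ _ s); apply: le_trans (le_bigmax _ _ a).
exact: le_bigmax.
Qed.

Lemma max_reward_le x : 0 <= x -> (forall s a s', reward M s a s' <= x) ->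
  max_reward <= x.
Proof.
by move=> x0 H; apply: bigmax_le => // s _; apply: bigmax_le => // a _;
  apply: bigmax_le => // s' _.
Qed.

Lemma RbarE : Rbar M = max_reward / (1 - discount M).
Proof. by rewrite mulrC. Qed.

Lemma max_rewardE : max_reward = (1 - discount M) * Rbar M.
Proof. by rewrite RbarE mulrC divfK // subr_eq0 gt_eqF // discount_lt1. Qed.

Lemma Rbar_ge0 : 0 <= Rbar M.
Proof.
by rewrite RbarE divr_ge0 ?max_reward_ge0 // subr_ge0 ltW // discount_lt1.
Qed.

Let stage (v : 'I_S -> R) s a s' := reward M s a s' + discount M * v s'.

Lemma stage_le v U s a s' : (forall s, v s <= U) ->
  stage v s a s' <= (1 - discount M) * Rbar M + discount M * U.
Proof.
move=> vU; rewrite -max_rewardE lerD ?reward_le_max //.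
by rewrite ler_wpM2l // ltW // discount_gt0.
Qed.

(** The nominal distribution is a good enough reply to every randomized action. The bound is affine
    in [U] with fixed point [Rbar M]. *)
Lemma bellman_le v U : (forall s, v s <= U) ->
  forall s, bellman phi M v s <= (1 - discount M) * Rbar M + discount M * U.
Proof.
move=> vU s; apply: (@maxmin_le R phi S A (nominal M s) (stage v s)) => //.
move=> pi eta pis eta0; exists (nominal M s).
  split=> [a|]; first exact: nominal_simplex.
  rewrite big1 ?ltW ?budget_gt0 // => a _.
  by apply: phi_div_nominal => // i; exact: nominal_gt0.
apply: mean_le => // a; apply: mean_le => [|i]; first exact: nominal_simplex.
apply: (@le_trans _ _ ((1 - discount M) * Rbar M + discount M * U)).
  exact: stage_le.
by rewrite lerDl ltW.
Qed.

(** The bound on the excess of the iterates over [Rbar M] shrinks by the factor [discount M] per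
    step and vanishes in the limit. *)
Lemma robust_value_le vstar : robust_value phi M vstar ->
  forall s, vstar s <= Rbar M.
Proof.
move=> [v0 cvg] s; pose D := \sum_s `|v0 s|.
have D0 : 0 <= D by apply: sumr_ge0.
have bnd t : forall s', iter t (bellman phi M) v0 s' <= Rbar M + discount M ^+ t * D.
  elim: t => [|t IH] s'.
    rewrite expr0 mul1r /= /D (bigD1 s') //= addrCA.
    apply: le_trans (ler_norm _) _; rewrite lerDl addr_ge0 ?Rbar_ge0 //.
    exact: sumr_ge0.
  rewrite iterS; apply: le_trans (bellman_le IH s') _.
  by rewrite le_eqVlt; apply/orP; left; apply/eqP; rewrite exprS; ring.
apply: (ler_cvg_to (cvg s) _ (nearW _ (fun t => bnd t s))).
rewrite -[X in (_ --> X)%classic]addr0; apply: cvgD; first exact: cvg_cst.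
rewrite -[X in (_ --> X)%classic](mul0r D); apply: cvgMl.
apply: cvg_expr; rewrite gtr0_norm ?discount_gt0 //; exact: discount_lt1.
Qed.

End RewardBound.

(** * Addresses in the lexicographic flattening of a three-index array *)

Section FlatIndices.
Variable R : realType.

Lemma mkseq_codom n (f : nat -> R) (g : 'I_n -> R) :
  (forall i : 'I_n, f i = g i) -> mkseq f n = codom g.
Proof.
move=> fg; rewrite /mkseq -val_enum_ord -map_comp /codom /image_mem.
by rewrite enumT; apply: eq_map => i /=; rewrite fg.
Qed.

Lemma nth_codom_ord n (g : 'I_n -> R) (i : 'I_n) : nth 0 (codom g) i = g i.
Proof.
rewrite -(@mkseq_codom n (fun k => g (insubd i k))) ?nth_mkseq ?valKd //.
by move=> j; rewrite valKd.
Qed.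

Lemma size_flatten_const (I T : Type) k (f : I -> seq T) s :
  (forall i, size (f i) = k) -> size (flatten [seq f i | i <- s]) = (size s * k)%N.
Proof. by move=> fk; elim: s => //= i s IH; rewrite size_cat fk IH mulSn. Qed.

Lemma nth_flatten_const (I T : Type) (x0 : T) (i0 : I) k (f : I -> seq T) s m j :
  (forall i, size (f i) = k) -> (m < size s)%N -> (j < k)%N ->
  nth x0 (flatten [seq f i | i <- s]) (m * k + j) = nth x0 (f (nth i0 s m)) j.
Proof.
move=> fk + jk; elim: s m => //= i s IH [|m] ms; rewrite nth_cat fk.
  by rewrite mul0n add0n jk.
by rewrite ltnNge mulSn -addnA leq_addr /= addKn IH.
Qed.

Variables (S A : nat) (f : 'I_S -> 'I_A -> 'I_S -> R).

Lemma size_flat3 : size (flat3 f) = (S * A * S)%N.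
Proof.
rewrite /flat3 (@size_flatten_const _ _ (A * S)%N) ?size_enum_ord ?mulnA // => s.
rewrite (@size_flatten_const _ _ S) ?size_enum_ord // => a.
by rewrite size_codom card_ord.
Qed.

Lemma nth_flat3 (s : 'I_S) (a : 'I_A) (i : 'I_S) :
  nth 0 (flat3 f) ((s * A + a) * S + i) = f s a i.
Proof.
have aS : (a * S + i < A * S)%N.
  apply: (@leq_trans (a.+1 * S)); last by rewrite leq_mul2r ltn_ord orbT.
  by rewrite mulSn addnC ltn_add2r.
rewrite mulnDl -mulnA -addnA /flat3 (@nth_flatten_const _ _ _ s) //.
- rewrite nth_ord_enum (@nth_flatten_const _ _ _ a S) ?size_enum_ord //.
    by rewrite nth_ord_enum nth_codom_ord.
  by move=> ?; rewrite size_codom card_ord.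
- move=> ?; rewrite (@size_flatten_const _ _ S) ?size_enum_ord // => ?.
  by rewrite size_codom card_ord.
- by rewrite size_enum_ord.
Qed.

Lemma flat3_index j : (j < S * A * S)%N ->
  exists (s : 'I_S) (a : 'I_A) (i : 'I_S), j = ((s * A + a) * S + i)%N.
Proof.
move=> jD; have S0 : (0 < S)%N by case: posnP jD => // ->; rewrite muln0.
have A0 : (0 < A)%N by case: posnP jD => // ->; rewrite muln0.
have h1 : (j %/ S < S * A)%N by rewrite ltn_divLR.
have h2 : (j %/ S %/ A < S)%N by rewrite ltn_divLR.
exists (Ordinal h2), (Ordinal (ltn_pmod (j %/ S) A0)), (Ordinal (ltn_pmod j S0)).
by rewrite /= -!divn_eq.
Qed.

End FlatIndices.

(** * Counting the halvings *)

Lemma ln2_ge (R : realType) : 2^-1 <= ln 2 :> R.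
Proof.
rewrite -[2^-1]expRK ler_ln ?posrE ?expR_gt0 //.
(* The inequality [1 + x <= expR x] at [x = - 1/2] shows that the exponential of [1/2] is at most
   2. *)
have := expR_ge1Dx (- 2^-1 : R); rewrite expRN => H.
rewrite -[leRHS]invrK -[leLHS]invrK lef_pV2 ?posrE ?invr_gt0 ?expR_gt0 //; lra.
Qed.

(** It suffices that [N * ln 2] exceeds [ln (r / eps) + ln 2], which [N >= 2 * L + 2] ensures
    because [ln 2 >= 1/2]. *)
Lemma halving_count (R : realType) (r eps : R) : 0 <= r -> 0 < eps ->
  r / 2 ^+ (Num.truncn (2 * Num.max 1 (ln (r / eps)))).+3 < eps / 2.
Proof.
move=> r0 eps0; set L := Num.max _ _.
have L1 : 1 <= L by rewrite le_max lexx.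
(* One unit compensates the truncation, the other two give the summand 2 of [NL]. *)
set N := (Num.truncn _).+3.
have NL : 2 * L + 2 <= N%:R.
  have := truncnS_gt (2 * L); rewrite /N -addn2 natrD => /ltW; lra.
clearbody N; have pN : 0 < 2 ^+ N :> R by rewrite exprn_gt0.
move: r0; rewrite le_eqVlt => /orP[/eqP <-|r0]; first by rewrite mul0r divr_gt0.
rewrite ltr_pdivrMr // mulrAC ltr_pdivlMr // [ltRHS]mulrC -ltr_pdivrMr // mulrAC.
have x0 : 0 < r / eps by rewrite divr_gt0.
suff : ln (r / eps * 2) < ln (2 ^+ N) by rewrite ltr_ln ?posrE // mulr_gt0.
rewrite lnM ?posrE // lnXn // -[ln 2 *+ N]mulr_natr.
have xL : ln (r / eps) <= L by rewrite le_max lexx orbT.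
have l2 := ln2_ge R.
apply: (@lt_le_trans _ _ (ln 2 * (2 * L + 2))); last by rewrite ler_pM2l //; lra.
have : 2^-1 * L <= ln 2 * L by rewrite ler_wpM2r //; lra.
lra.
Qed.

(** * Guarantees of the program on a given robust MDP *)

Section Solve.
Variables (R : realType) (phi : R -> R).
Hypothesis hphi : divergence_function phi.
Variables (S A : nat) (M : rmdp R S A) (vstar v : 'I_S -> R) (eps : R).
Hypotheses (S0 : (0 < S)%N) (A0 : (0 < A)%N).
Hypotheses (hvstar : robust_value phi M vstar) (hv : forall s, v s <= vstar s).
Hypothesis stage_ge0 : forall s a s', 0 <= reward M s a s' + discount M * v s'.
Hypothesis eps0 : 0 < eps.

Let b s a s' := reward M s a s' + discount M * v s'.
Let proj s a beta := projection phi (nominal M s a) (b s a) beta.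
Let delta := eps * budget M / (2 * A%:R * Rbar M + A%:R * eps).

Lemma delta_gt0 : 0 < delta.
Proof.
have A1 : 0 < A%:R :> R by rewrite ltr0n.
rewrite divr_gt0 ?mulr_gt0 ?budget_gt0 // ltr_wpDl ?mulr_gt0 //.
by rewrite mulr_ge0 ?Rbar_ge0 // mulr_ge0.
Qed.

(** Here the assumption [v <= vstar] enters: it yields [v <= Rbar M], and [Rbar M] is the fixed
    point of the one-stage bound. *)
Lemma stage_le_Rbar s a s' : b s a s' <= Rbar M.
Proof.
have := @stage_le R S A M v (Rbar M) s a s' _; rewrite mulrBl mul1r subrK; apply.
by move=> ?; apply: le_trans (hv _) (robust_value_le hphi A0 hvstar _).
Qed.

(** Any action secures 0 by nonnegativity of the payoffs; at the threshold [Rbar M] all projections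
    are trivial, which gives the upper bound. *)
Lemma bellman_bounds s : 0 <= bellman phi M v s <= Rbar M.
Proof.
have Rb := stage_le_Rbar.
have nom := @nominal_gt0 R S A M s; have noms := @nominal_simplex R S A M s.
apply/andP; split.
  by apply: (@maxmin_ge_min R phi hphi S A (nominal M s) (b s) (budget M) nom noms
    (budget_gt0 M) 0 (Ordinal A0)) => i; exact: stage_ge0.
apply: (@maxmin_le_projection R phi hphi S A (nominal M s) (b s) (budget M) nom noms
    (budget_gt0 M) A0).
  by move=> a; exists (Ordinal S0).
apply: (@le_trans _ _ 0); last exact: ltW (budget_gt0 M).
apply: sumr_le0 => a _; apply: projection_trivial => //.
under eq_bigr do rewrite mulrC.
by apply: mean_le.
Qed.

(** The concrete instance of [spec], phrased so that it serves all three branches of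
    [projection_call]. *)
Definition projection_bound s a beta u :=
  ((exists i, b s a i <= beta) -> proj s a beta <= u <= proj s a beta + delta) /\
  ((forall i, beta < b s a i) -> budget M + 1 <= u).

Lemma bisection_decision s beta (u : 'I_A -> R) : 0 <= beta < Rbar M ->
  (forall a, projection_bound s a beta (u a)) ->
  if \sum_a u a <= budget M then bellman phi M v s <= beta
  else beta - eps / 2 <= bellman phi M v s.
Proof.
move=> beta01 Hu.
have nom := @nominal_gt0 R S A M s; have noms := @nominal_simplex R S A M s.
have k0 := budget_gt0 M.
have [feas|] := pselect (forall a, exists i, b s a i <= beta).
  case: ifPn => Hs.
    apply: (@maxmin_le_projection R phi hphi S A (nominal M s) (b s) (budget M) nom noms
      k0 A0) => //.
    apply: le_trans Hs; apply: ler_sum => a _.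
    by have /andP[] := (Hu a).1 (feas a).
  apply: (@maxmin_ge_approx R phi hphi S A (nominal M s) (b s) (budget M) nom noms
      k0 (Rbar M)) => //.
    move=> a; under eq_bigr do rewrite mulrC.
    by apply: mean_le => // i; exact: stage_le_Rbar.
  rewrite -ltNge in Hs.
  have H : \sum_a u a <= \sum_a (proj s a beta + delta).
    by apply: ler_sum => a _; have /andP[] := (Hu a).1 (feas a).
  rewrite big_split /= sumr_const card_ord in H.
  (* The choice of [delta] makes the total error of the [A] projections equal to the loss that
     [maxmin_ge_approx] tolerates. *)
  have Ed : delta *+ A = budget M * (eps / (2 * Rbar M + eps)).
    have A1 : 0 < A%:R :> R by rewrite ltr0n.
    have R0 := Rbar_ge0 M.
    rewrite -mulr_natr /delta; field.
    have RA : 0 <= 2 * A%:R * Rbar M by apply: mulr_ge0 => //; exact: mulr_ge0.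
    have R2 : 0 <= 2 * Rbar M by exact: mulr_ge0.
    by rewrite !gt_eqF // ltr_wpDl // mulr_gt0.
  rewrite Ed in H; rewrite lerBlDr; exact: le_trans (ltW Hs) H.
(* An action infeasible at [beta] pays more than [beta] everywhere: it makes the test fail, and
   playing it justifies this outcome. *)
move=> /existsNP[a0 /forallNP Ha0].
have {}Ha0 i : beta < b s a0 i by rewrite ltNge; apply/negP.
have u0 a : 0 <= u a.
  have [fa|] := pselect (exists i, b s a i <= beta).
    have /andP[+ _] := (Hu a).1 fa; apply: le_trans.
    by apply: projection_ge0.
  move=> /forallNP H; apply: le_trans ((Hu a).2 _); first by rewrite addr_ge0 // ltW.
  by move=> i; rewrite ltNge; apply/negP.
have : budget M < \sum_a u a.
  rewrite (bigD1 a0) //=; apply: (@lt_le_trans _ _ (u a0)).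
    by apply: lt_le_trans ((Hu a0).2 Ha0); rewrite ltrDl.
  by rewrite lerDl sumr_ge0.
rewrite ltNge => /negbTE ->; apply: (@le_trans _ _ beta).
  by rewrite gerBl divr_ge0 // ltW.
by apply: (@maxmin_ge_min R phi hphi S A (nominal M s) (b s) (budget M) nom noms
    k0 beta a0) => i; exact: ltW.
Qed.

Variables (P : com R) (T : R -> R).
Hypothesis hP : projections_in_time phi M P T.
Variable K : nat.
Hypothesis KT : (Num.truncn (T delta) + 5 <= K)%N.

Let le_truncn_time n : n%:R <= T delta -> (n <= Num.truncn (T delta))%N.
Proof. by move=> H; rewrite truncn_ge_nat // (le_trans _ H). Qed.

(** Reading the input is charged, so the time of a nontrivial projection dominates the size of its
    input. For [S >= 2] such a projection exists; for [S = 1] the summand 5 in [KT] suffices. *)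
Lemma size_le_time : (2 + S + S <= K)%N.
Proof.
have [S1|S1] := leqP S 1; first lia.
pose i1 : 'I_S := Ordinal S1; pose i0 : 'I_S := Ordinal S0.
(* With the indicator of [i1] as payoff, the threshold 0 is attained at [i0] while the nominal mean
   is positive. *)
have H : nontrivial_projection (nominal M i0 (Ordinal A0)) (fun i => (i == i1)%:R) 0.
  split; first by exists i0.
  under eq_bigr do rewrite mulrC.
  by rewrite sum_dirac nominal_gt0.
have [t [st [_ + _]]] := hP (s := i0) (a := Ordinal A0) (b := fun i => (i == i1)%:R)
   (beta := 0) (fun=> ler0n _ _) (lexx _) H delta_gt0.
by move=> /le_truncn_time; rewrite /= !size_cat !size_codom card_ord; lia.
Qed.

Lemma projection_run s a beta : 0 <= beta ->
  (exists i, b s a i <= beta) -> beta < \sum_i b s a i * nominal M s a i ->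
  reaches P (load [:: S] ([:: beta; delta] ++ codom (b s a) ++ codom (nominal M s a)))
    K (fun st => projection_bound s a beta (memory st 1%N)).
Proof.
move=> beta0 feas nt.
have [t [st [e + [/andP[lo hi] gap]]]] := hP (s := s) (a := a) (b := b s a)
  (stage_ge0 s a) beta0 (conj feas nt) delta_gt0.
move=> /le_truncn_time tT; exists t, st; split=> //; first lia.
split=> [_|H]; first by rewrite hi /=; move: lo gap; rewrite -/(proj s a beta); lra.
by have [i] := feas; rewrite leNgt H.
Qed.

Lemma bellman_run N : Rbar M / 2 ^+ N < eps / 2 ->
  let xs := [:: discount M; budget M; eps] ++ codom v ++
       flat3 (reward M) ++ flat3 (nominal M) in
  reaches (bellman_prog P) (load [:: S; A] xs) (2000 * (S * (N.+1 * (A * K))))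
    (fun st => forall s : 'I_S, `|memory st s - bellman phi M v s| <= eps).
Proof.
move=> HN xs.
(* The program is verified over natural indices; those out of range are sent to index 0. *)
pose sN (n : nat) : 'I_S := insubd (Ordinal S0) n.
pose aN (n : nat) : 'I_A := insubd (Ordinal A0) n.
have xs3 k : nth 0 xs (3 + k) =
    nth 0 (codom v ++ flat3 (reward M) ++ flat3 (nominal M)) k by [].
have xsS k : nth 0 xs (3 + S + k) = nth 0 (flat3 (reward M) ++ flat3 (nominal M)) k.
  by rewrite -addnA xs3 nth_cat size_codom card_ord ltnNge leq_addr /= addKn.
have m_v (i : 'I_S) : nth 0 xs (3 + i) = v i.
  by rewrite xs3 nth_cat size_codom card_ord ltn_ord nth_codom_ord.
have m_r (s : 'I_S) (a : 'I_A) (i : 'I_S) :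
    nth 0 xs (3 + S + ((s * A + a) * S + i)) = reward M s a i.
  by rewrite xsS nth_cat size_flat3 flat_index_lt // nth_flat3.
have m_q (s : 'I_S) (a : 'I_A) (i : 'I_S) :
    nth 0 xs (3 + S + S * A * S + ((s * A + a) * S + i)) = nominal M s a i.
  by rewrite -(addnA (3 + S)) xsS nth_cat size_flat3 ltnNge leq_addr /= addKn nth_flat3.
have bE (s : 'I_S) (a : 'I_A) (i : 'I_S) :
    nth 0 xs (3 + S + ((s * A + a) * S + i)) + discount M * nth 0 xs (3 + i) = b s a i.
  by rewrite m_r m_v.
have ordP p n : (n < p)%N -> exists i : 'I_p, n = i by move=> np; exists (Ordinal np).
have sumE (s : 'I_S) (a : 'I_A) :
    \sum_(i < S) (nth 0 xs (3 + S + ((s * A + a) * S + i)) +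
                  discount M * nth 0 xs (3 + i)) *
      nth 0 xs (3 + S + S * A * S + ((s * A + a) * S + i)) =
    \sum_i b s a i * nominal M s a i.
  by apply: eq_bigr => i _; rewrite bE m_q.
apply: (reaches_conseq (@bellman_prog_correct R P S A K
  (3 + S + S * A * S + S * A * S) (nth 0 xs) erefl _ S0 A0 size_le_time
  (max_reward M) (max_reward_ge0 M) _ _
  (fun s a beta u => projection_bound (sN s) (aN a) beta u) _ _ _
  (fun s => bellman phi M v (sN s)) _ _ eps0 N _)) => //.
- by rewrite -(addnA (3 + S)) leq_addr.
- move=> j /flat3_index[s [a [i ->]]]; rewrite m_r; exact: reward_le_max.
- move=> x x0 H; apply: max_reward_le => // s a i.
  by rewrite -m_r; apply: H; exact: flat_index_lt.
- move=> n k beta /ordP[s ->] /ordP[a ->] beta0 [j /ordP[i ->]].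
  rewrite bE sumE /sN /aN !valKd => bi nt.
  rewrite (mkseq_codom (bE s a)) (mkseq_codom (m_q s a)) -RbarE.
  by apply: projection_run => //; exists i.
- move=> n k beta /ordP[s ->] /ordP[a ->]; rewrite sumE /sN /aN !valKd => le_beta.
  (* A trivial projection has value 0, and it cannot be infeasible, since the nominal mean would
     then exceed [beta]. *)
  split=> [feas|lt_b].
    have p0 : 0 <= proj s a beta by apply: projection_ge0 => // i; exact: nominal_gt0.
    have p1 : proj s a beta <= 0.
      by apply: projection_trivial => // [i|]; [exact: nominal_gt0|exact: nominal_simplex].
    by rewrite p1 addr_ge0 // ltW // delta_gt0.
  have := mean_gt (nominal_simplex M s a) lt_b.
  by under eq_bigr do rewrite mulrC; rewrite ltNge le_beta.
- move=> n k beta /ordP[s ->] /ordP[a ->] lt_b; rewrite /sN /aN !valKd.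
  split=> // -[i]; rewrite leNgt => /negP[].
  by rewrite -bE; apply: lt_b.
- by move=> n /ordP[s ->]; rewrite /sN valKd -RbarE; exact: bellman_bounds.
- move=> n beta u /ordP[s ->]; rewrite /sN valKd -RbarE => beta01 Hu.
  apply: (@bisection_decision s beta (fun a => u a)) => // a.
  by have := Hu a (ltn_ord a); rewrite /aN valKd.
- by rewrite -RbarE.
- by move=> st H s; have := H s (ltn_ord s); rewrite /sN valKd.
Qed.

End Solve.

(** * The running time bound, with program and constant uniform over all instances *)

Theorem theorem1 (R : realType) (phi : R -> R) (hphi : divergence_function phi)
    (P : com R) (C : R) (hC : 0 < C) :
  exists (Q : com R) (C' : R), 0 < C' /\
    forall (S A : nat) (hS : (0 < S)%N) (hA : (0 < A)%N) (M : rmdp R S A)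
      (h : R -> R) (h_ge1 : forall delta, 0 < delta -> 1 <= h delta),
      projections_in_time phi M P (fun delta => C * h delta) ->
      forall (vstar v : 'I_S -> R), robust_value phi M vstar ->
      (forall s, v s <= vstar s) ->
      (forall s a s', 0 <= reward M s a s' + discount M * v s') ->
      forall eps : R, 0 < eps ->
      bellman_in_time phi M Q v eps
        (C' * (A%:R * S%:R *
               h (eps * budget M / (2 * A%:R * Rbar M + A%:R * eps)) *
               Num.max 1 (ln (Rbar M / eps)))).
Proof.
(* Naming the constant keeps the unary numeral from being unfolded. *)
have [c c_eq] : exists c, c = 2010%N by exists 2010%N.
have c0 : 0 < c%:R :> R by rewrite ltr0n c_eq.
(* The factor [c] covers the 2000 of [bellman_run] and the reading of the input; 6 comes from
   [N.+1 <= 6 * L] and [C + 5] from [K <= (C + 5) * h delta]. *)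
exists (bellman_prog P), (c%:R * (6 * (C + 5))); split.
  by apply: mulr_gt0 => //; apply: mulr_gt0 => //; apply: addr_gt0.
move=> S A hS hA M h h_ge1 hP vstar v hvstar hv stage0 eps eps0.
set delta := eps * budget M / _.
have H1 := h_ge1 _ (delta_gt0 M hA eps0); rewrite -/delta in H1.
set L := Num.max 1 _.
have L1 : 1 <= L by rewrite le_max lexx.
set N := (Num.truncn (2 * L)).+3.
set K := (Num.truncn (C * h delta) + 5)%N.
have HN : Rbar M / 2 ^+ N < eps / 2 by apply: halving_count => //; exact: Rbar_ge0.
have [t [st [e tT post]]] := @bellman_run R phi hphi S A M vstar v eps hS hA hvstar
  hv stage0 eps0 P (fun delta => C * h delta) hP K (leqnn _) N HN.
exists t, st; split=> //.
have SK : (2 + S + S <= K)%N :=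
  size_le_time hS hA eps0 hP (leqnn _).
rewrite !size_cat !size_flat3 size_codom card_ord.
(* Here and in [NR], [h delta >= 1] and [L >= 1] absorb the additive constants. *)
have KR : K%:R <= (C + 5) * h delta.
  have := truncn_le (C * h delta); rewrite (mulr_ge0 (ltW hC)) ?(le_trans ler01) // => Kle.
  rewrite /K natrD mulrDl lerD // -[leLHS]mulr1 ler_wpM2l //.
have NR : N.+1%:R <= 6 * L.
  have := truncn_le (2 * L); rewrite mulr_ge0 // ?(le_trans ler01) // => Nle.
  rewrite /N -addn4 natrD; lra.
have tot : (size [:: S; A] + (size [:: discount M; budget M; eps] +
    (S + (S * A * S + S * A * S))) + t <= c * (S * A * (N.+1 * K)))%N.
  have h1 : (S * A * K <= S * A * (N.+1 * K))%N by rewrite leq_mul2l leq_pmull ?orbT.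
  have h2 : (S * A * (2 + S + S) <= S * A * K)%N by rewrite leq_mul2l SK orbT.
  have h3 : (S <= S * A)%N by rewrite leq_pmulr.
  rewrite (mulnCA N.+1) (mulnA S) in tT; rewrite !mulnDr in h2.
  by move: tT h1; rewrite c_eq /=; move: (S * A * (N.+1 * K))%N => X; lia.
apply: le_trans (_ : (c * (S * A * (N.+1 * K)))%:R <= _); first by rewrite ler_nat.
have NK : N.+1%:R * K%:R <= 6 * L * ((C + 5) * h delta) by rewrite ler_pM.
have cSA : 0 <= c%:R * (S%:R * A%:R) :> R by rewrite !mulr_ge0 // ltW.
have regroup (x y z w l d : R) : x * (6 * w) * (y * z * d * l) =
    x * (z * y) * (6 * l * (w * d)) by ring.
by rewrite regroup !natrM mulrA ler_wpM2l.
Qed.
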